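(* Let $K\subset\mathbb{R}$ be a real quadratic field, $L\subset K$ a free $\mathbb{Z}$-submodule of rank two, $l_0,m_0\in K$, $\eta=\eta_0+i\eta_1\in\mathbb{C}$ ($\eta_0,\eta_1\in\mathbb{R}$), and let $U$ be an infinite cyclic group of totally positive units of $K$ satisfying conditions (a), (b) of the context. Let $\varepsilon>1$ be a generator of $U$. Then for all $v$ in the upper half plane $$\Theta^U_{L,\eta}\left[{l_0\atop m_0}\right](v)=\sqrt{-iv}\int_{-\log\varepsilon}^{\log\varepsilon}\theta_{\Lambda_t,\eta}\left[{\lambda_{0,t}\atop\mu_{0,t}}\right](v)\,dt .$$
   Context: $l\mapsto l'$ denotes the nontrivial element of $\mathrm{Gal}(K/\mathbb{Q})$, $\mathrm{tr}=\mathrm{tr}_{K/\mathbb{Q}}$; $\mathrm{sgn}(0)=0$; $\sqrt{-iv}$ is the branch positive on the positive imaginary axis. Conditions on $U$: (a) $u(l_0+L)=l_0+L$ for all $u\in U$; (b) $\mathrm{tr}((ul)'m_0)\equiv\mathrm{tr}(l'm_0)\bmod\mathbb{Z}$ and $\mathrm{tr}((ul_0)'m_0)\equiv\mathrm{tr}(l_0'm_0)\bmod 2\mathbb{Z}$ for all $l\in L$, $u\in U$. Theta function of the pseudolattice: $$\Theta^U_{L,\eta}\left[{l_0\atop m_0}\right](v)=\sum_{l_0+l\bmod U}\bigl(\eta_0\,\mathrm{sgn}(l_0'+l')+\eta_1\,\mathrm{sgn}(l_0+l)\bigr)e^{2\pi iv|(l_0+l)(l_0'+l')|}e^{-2\pi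 i\,\mathrm{tr}(l'm_0)}e^{-\pi i\,\mathrm{tr}(l_0'm_0)},$$ the sum running over a system of representatives $l_0+l$ ($l\in L$) of the orbits of $U$ acting on $l_0+L$. Complex lattices: for $t\in\mathbb{R}$, $\Lambda_t=\{le^{t/2}+il'e^{-t/2}: l\in L\}\subset\mathbb{C}$, $\lambda_{0,t}=l_0e^{t/2}+il_0'e^{-t/2}$, $\mu_{0,t}=m_0e^{t/2}+im_0'e^{-t/2}$. On $\mathbb{C}$ use the real scalar product $(x\cdot y)=\mathrm{Im}(xy)=x_0y_1+x_1y_0$ for $x=x_0+ix_1$, $y=y_0+iy_1$. For a lattice $\Lambda\subset\mathbb{C}$ and $\lambda_0,\mu_0\in\mathbb{C}$, $$\theta_{\Lambda,\eta}\left[{\lambda_0\atop\mu_0}\right](v)=\sum_{\lambda\in\Lambda}((\lambda_0+\lambda)\cdot\eta)\,e^{\pi iv|\lambda_0+\lambda|^2}e^{-2\pi i(\lambda\cdot\mu_0)-\pi i(\lambda_0\cdot\mu_0)} .$$ *)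

(* Defs.v *)
From HB Require Import structures.
From mathcomp Require Import all_boot all_order all_algebra all_fingroup all_field.
From mathcomp Require Import complex.
From mathcomp Require Import all_classical all_reals all_analysis.

Set Implicit Arguments.
Unset Strict Implicit.
Unset Printing Implicit Defensive.

Import Order.TTheory GRing.Theory Num.Theory.
Import numFieldNormedType.Exports.

Local Open Scope classical_set_scope.
Local Open Scope ring_scope.
Local Open Scope complex_scope.

Section ComplexAnalysis.
Context {R : realType}.

Definition cexp (z : R[i]) : R[i] :=
  (expR (complex.Re z))%:C * (cos (complex.Im z) +i* sin (complex.Im z)).

Definition abs_summable {T : choiceType} (D : set T) (f : T -> R[i]) : Prop :=
  summable D (fun x => (ComplexField.Normc.normc (f x))%:E).

(* Sum of an absolutely summable family: positive part minus negative part.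
   Without absolute summability the value is meaningless. *)
Definition rsum {T : choiceType} (D : set T) (f : T -> R) : R :=
  fine (\esum_(x in D) (f^\+ x)%:E) - fine (\esum_(x in D) (f^\- x)%:E).

Definition csum {T : choiceType} (D : set T) (f : T -> R[i]) : R[i] :=
  rsum D (fun x => complex.Re (f x)) +i* rsum D (fun x => complex.Im (f x)).

Definition cintegrable (a b : R) (f : R -> R[i]) : Prop :=
  lebesgue_measure.-integrable `[a, b] (fun t => (complex.Re (f t))%:E) /\
  lebesgue_measure.-integrable `[a, b] (fun t => (complex.Im (f t))%:E).

Definition cintegral (a b : R) (f : R -> R[i]) : R[i] :=
  (\int[lebesgue_measure]_(t in `[a, b]) complex.Re (f t)) +i*
  (\int[lebesgue_measure]_(t in `[a, b]) complex.Im (f t)).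

(* The real scalar product x0 y1 + x1 y0. *)
Definition sprod (x y : R[i]) : R := complex.Im (x * y).

Definition theta_term (eta lambda0 mu0 v lambda : R[i]) : R[i] :=
  (sprod (lambda0 + lambda) eta)%:C
  * cexp (pi%:C * 'i%C * v * `|lambda0 + lambda| ^+ 2)
  * cexp (- (2 * pi%:C * 'i%C * (sprod lambda mu0)%:C)
          - pi%:C * 'i%C * (sprod lambda0 mu0)%:C).

Definition theta (Lambda : set R[i]) (eta lambda0 mu0 v : R[i]) : R[i] :=
  csum Lambda (theta_term eta lambda0 mu0 v).

End ComplexAnalysis.

Section Pseudolattice.
(* A quadratic field K inside the reals is given with its inclusion iota, and
   sigma is meant to be the nontrivial element of its Galois group over Q. *)
Context {R : realType} {K : splittingFieldType rat}.
Variables (iota : {rmorphism K -> R}) (sigma : gal_of {:K}).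

Definition trQ (x : K) : K := galTrace 1%VS {:K}%VS x.

Definition congr_mod (n : nat) (x y : K) : Prop :=
  exists k : int, x - y = k%:~R *+ n.

Definition free_rank2 (L : set K) : Prop :=
  exists a b : K,
    (forall m n : int, a *~ m + b *~ n = 0 -> m = 0 /\ n = 0) /\
    L = [set x | exists m n : int, x = a *~ m + b *~ n].

Definition translate (l0 : K) (L : set K) : set K := [set l0 + l | l in L].

(* Units of the ring of integers of K. *)
Definition field_unit (u : K) : Prop :=
  [/\ u != 0, integralOver (intr : int -> K) u
    & integralOver (intr : int -> K) u^-1].

Definition totally_positive (u : K) : Prop :=
  0 < iota u /\ 0 < iota (sigma u).

Definition generator_of (U : set K) (eps : K) : Prop :=
  U = [set eps ^ k | k in [set: int]].

Definition preserves_coset (U L : set K) (l0 : K) : Prop :=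
  forall u, U u -> [set u * x | x in translate l0 L] = translate l0 L.

Definition preserves_character (U L : set K) (l0 m0 : K) : Prop :=
  forall l u, L l -> U u ->
    congr_mod 1 (trQ (sigma (u * l) * m0)) (trQ (sigma l * m0)) /\
    congr_mod 2 (trQ (sigma (u * l0) * m0)) (trQ (sigma l0 * m0)).

(* S is a system of representatives of the orbits of U acting on A by
   multiplication. *)
Definition orbit_representatives (U A S : set K) : Prop :=
  S `<=` A /\
  forall x, A x -> exists! s, S s /\ exists2 u, U u & x = u * s.

(* The summand is a function of x = l0 + l. *)
Definition Theta_term (eta : R[i]) (l0 m0 : K) (v : R[i]) (x : K) : R[i] :=
  (complex.Re eta * Num.sg (iota (sigma x)) + complex.Im eta * Num.sg (iota x))%:C
  * cexp (2 * pi%:C * 'i%C * v * `|iota (x * sigma x)|%:C)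
  * cexp (- (2 * pi%:C * 'i%C * (iota (trQ (sigma (x - l0) * m0)))%:C))
  * cexp (- (pi%:C * 'i%C * (iota (trQ (sigma l0 * m0)))%:C)).

(* S is a system of representatives of the orbits of U on l0 + L. *)
Definition Theta (S : set K) (eta : R[i]) (l0 m0 : K) (v : R[i]) : R[i] :=
  csum S (Theta_term eta l0 m0 v).

(* Sends l0, m0 and the elements of L to lambda_{0,t}, mu_{0,t} and Lambda_t. *)
Definition cplx_point (t : R) (x : K) : R[i] :=
  (iota x * expR (t / 2)) +i* (iota (sigma x) * expR (- t / 2)).

Definition cplx_lattice (t : R) (L : set K) : set R[i] := cplx_point t @` L.

End Pseudolattice.

(* Main.v *)
(* Unfolding.  Write f_x(t), x in l0 + L, for the summand of the theta series
   of the lattice Lambda_t.  A unit eps^k acts on the family by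
   f_(eps^k x)(t) = f_x(t + 2 k log eps), because eps has norm 1 and because of
   the two congruences.  Hence the integral over [-log eps, log eps] of the sum
   over l0 + L is the sum over the orbits of the integrals of f_x over the whole
   line.  With X = x e^(t/2), X' = x' e^(-t/2), s = sgn(x x'), q = X - sX' and
   p = X + sX' one has X^2 + X'^2 = q^2 + 2|xx'| = p^2 - 2|xx'|, q' = p/2 and
   p' = q/2, so that f_x is the derivative of a combination of G(q) and G(p),
   where G is a primitive of r |-> e^(pi i v r^2).  What remains is the Gaussian
   integral with a complex parameter. *)
Require Import Defs.
From HB Require Import structures.
From mathcomp Require Import all_boot all_order all_algebra all_fingroup all_field.
From mathcomp Require Import complex.
From mathcomp Require Import all_classical all_reals all_analysis.
From mathcomp Require Import measurable_realfun ring lra.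

Set Implicit Arguments.
Unset Strict Implicit.
Unset Printing Implicit Defensive.

Import Order.TTheory GRing.Theory Num.Theory.
Import numFieldNormedType.Exports.

Local Open Scope classical_set_scope.
Local Open Scope ring_scope.
Local Open Scope complex_scope.

(** * Integration of sums over countable sets *)

Section Sums.
Context {R : realType}.
Local Open Scope ereal_scope.

(** The sums are unordered and signed, each a difference of two nonnegative sums, so every exchange
    is Tonelli for nonnegative functions of the real and imaginary parts of f_x, followed by a
    subtraction. One majorant, summable over l0 + L and uniform on [-log eps, log eps], makes the
    subtraction legitimate; unfolding the absolute values with it yields the integrability of each
    f_x, x nonzero, on the line and the absolute convergence over the orbits. The signs in the
    pseudolattice series record a direction of travel: q runs from -sgn(x) oo to sgn(x) oo, while p
    returns to where it started. Since X = (p + q)/2 and sX' = (p - q)/2, the coefficient of p in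
    the scalar product is (eta_1 + s eta_0)/2, and sgn(x)(eta_1 + s eta_0) = eta_0 sgn(x') + eta_1
    sgn(x). For the Gaussian integral I, integration by parts and differentiation in Re v show that
    -iv I^2 is constant along horizontal lines. This leaves a sign, which Re I > 0 decides. *)

Lemma countable_nat_bij (T : Type) (X : set T) : countable X -> X !=set0 ->
  exists (P : set nat) (e : nat -> T), set_bij P X e.
Proof.
move=> /countable_injP[j jinj] [x0 Xx0].
have /choice[e eP] : forall n, exists x, (j @` X) n -> X x /\ j x = n.
  move=> n; have [[x Xx <-]|nP] := pselect ((j @` X) n); first by exists x.
  by exists x0.
exists (j @` X), e; split.
- by move=> n /eP[].
- move=> m n /set_mem/eP[_ em] /set_mem/eP[_ en] mn.
  by rewrite -em -en mn.
- move=> x Xx; exists (j x); first by exists x.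
  have [|Xe je] := eP (j x); first by exists x.
  by apply: jinj => //; rewrite ?inE.
Qed.

(** Padding with zeros outside [P] treats finite and infinite [X] alike and gives access to the
    theorems on series of nonnegative functions. *)
Lemma esum_series (T : choiceType) (X : set T) (P : set nat) (e : nat -> T)
    (a : T -> \bar R) : set_bij P X e -> (forall x, X x -> 0 <= a x) ->
  \esum_(x in X) a x = \sum_(n <oo) (if n \in P then a (e n) else 0).
Proof.
move=> Pe a0; rewrite (reindex_esum P X e)// esum_mkcond nneseries_esumT//.
move=> n; case: ifP => // /set_mem Pn; apply: a0.
by case: Pe => + _ _; apply.
Qed.

Section integral.
Context d (Y : measurableType d) (mu : {measure set Y -> \bar R}).
Variables (D : set Y) (mD : measurable D).
Context (T : choiceType) (X : set T) (cX : countable X).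
Variable f : T -> Y -> \bar R.
Hypothesis mf : forall x, X x -> measurable_fun D (f x).
Hypothesis f0 : forall x y, X x -> D y -> 0 <= f x y.

Lemma measurable_esum :
  measurable_fun D (fun y => \esum_(x in X) f x y).
Proof.
have [->|/set0P X0] := eqVneq X set0.
  by under eq_fun do rewrite esum_set0; exact: measurable_cst.
have [P [e Pe]] := countable_nat_bij cX X0.
have PX n : P n -> X (e n) by case: Pe => + _ _; apply.
apply: (eq_measurable_fun
    (fun y => \sum_(n <oo) (if n \in P then f (e n) y else 0))).
  by move=> y /set_mem Dy; rewrite (esum_series Pe)// => x Xx; exact: f0.
apply: ge0_emeasurable_sum => n y.
  by move=> Dy _; case: ifP => // /set_mem /PX Xn; exact: f0.
by move=> _; case: (boolP (n \in P)) => [/set_mem /PX Xn|_]; [exact: mf|exact: measurable_cst].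
Qed.

Lemma integral_esum :
  \int[mu]_(y in D) (\esum_(x in X) f x y) =
  \esum_(x in X) \int[mu]_(y in D) f x y.
Proof.
have [->|/set0P X0] := eqVneq X set0.
  by rewrite esum_set0; under eq_integral do rewrite esum_set0; exact: integral0.
have [P [e Pe]] := countable_nat_bij cX X0.
have PX n : P n -> X (e n) by case: Pe => + _ _; apply.
rewrite (esum_series Pe); last by move=> x Xx; apply: integral_ge0 => y; exact: f0.
transitivity (\int[mu]_(y in D)
    (\sum_(n <oo) (if n \in P then f (e n) y else 0))).
  apply: eq_integral => y /set_mem Dy; rewrite (esum_series Pe)// => x Xx.
  exact: f0.
rewrite integral_nneseries//.
- apply: eq_eseriesr => n _; case: ifP => // _; exact: integral0.
- by move=> n; case: (boolP (n \in P)) => [/set_mem /PX Xn|_]; [exact: mf|exact: measurable_cst].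
- by move=> n y Dy; case: ifP => // /set_mem /PX Xn; exact: f0.
Qed.

End integral.
End Sums.

(** * Signed sums, and the line cut into translates of one interval *)

Section Unfolding.
Context {R : realType}.
Local Notation mu := (@lebesgue_measure R).
Local Open Scope ereal_scope.

Lemma esum_support1 (T : choiceType) (X : set T) (x0 : T) (a : T -> \bar R) :
  X x0 -> (forall x, X x -> 0 <= a x) -> (forall x, X x -> x <> x0 -> a x = 0) ->
  \esum_(x in X) a x = a x0.
Proof.
move=> Xx0 a0 ax; rewrite (esumID [set x0])// (_ : X `&` [set x0] = [set x0]).
  rewrite esum_set1 ?a0// esum1 ?adde0// => x [Xx /= nx]; exact: ax.
by apply/seteqP; split => [x []//|x /= ->].
Qed.

(** Here [g] and [h] may overlap, so they need not be the positive and negative parts from which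
    [rsum] is defined. This freedom is behind the linearity of [rsum] and the exchange with the
    integral. *)
Lemma rsumE (T : choiceType) (X : set T) (g h : T -> R) :
  (forall x, X x -> (0 <= g x)%R) -> (forall x, X x -> (0 <= h x)%R) ->
  \esum_(x in X) (g x)%:E < +oo -> \esum_(x in X) (h x)%:E < +oo ->
  rsum X (fun x => g x - h x)%R =
  (fine (\esum_(x in X) (g x)%:E) - fine (\esum_(x in X) (h x)%:E))%R.
Proof.
move=> g0 h0 gfin hfin.
have sg : summable X (EFin \o g).
  by rewrite /summable (eq_esum (b := EFin \o g))// => x Xx; rewrite gee0_abs// lee_fin g0.
have sh : summable X (EFin \o h).
  by rewrite /summable (eq_esum (b := EFin \o h))// => x Xx; rewrite gee0_abs// lee_fin h0.
have fing : \esum_(x in X) (g x)%:E \is a fin_num.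
  by rewrite ge0_fin_numE// esum_ge0// => x /g0; rewrite lee_fin.
have finh : \esum_(x in X) (h x)%:E \is a fin_num.
  by rewrite ge0_fin_numE// esum_ge0// => x /h0; rewrite lee_fin.
have := @esumB _ _ X (EFin \o g) (EFin \o h) sg sh.
rewrite /rsum -[((EFin \o g) \- (EFin \o h))]/(EFin \o (fun x => g x - h x)%R).
rewrite funerpos funerneg => /(_ _ _)/(congr1 fine).
move=> E; rewrite -[RHS]fineB// -{}E; last 2 first.
  - by move=> x /g0; rewrite /= lee_fin.
  - by move=> x /h0; rewrite /= lee_fin.
have sgh := summableB sg sh.
rewrite fineB//.
  rewrite ge0_fin_numE; last by apply: esum_ge0 => x _; rewrite lee_fin funrpos_ge0.
  have := summable_funepos sgh; rewrite /summable.
  rewrite -[((EFin \o g) \- (EFin \o h))]/(EFin \o (fun x => g x - h x)%R) funerpos.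
  rewrite (eq_esum (b := EFin \o ((fun x => g x - h x)^\+)%R))// => x Xx.
  by rewrite gee0_abs// lee_fin funrpos_ge0.
rewrite ge0_fin_numE; last by apply: esum_ge0 => x _; rewrite lee_fin funrneg_ge0.
have := summable_funeneg sgh; rewrite /summable.
rewrite -[((EFin \o g) \- (EFin \o h))]/(EFin \o (fun x => g x - h x)%R) funerneg.
rewrite (eq_esum (b := EFin \o ((fun x => g x - h x)^\-)%R))// => x Xx.
by rewrite gee0_abs// lee_fin funrneg_ge0.
Qed.

Lemma derive1_shiftr (c : R) : derive1 (fun t : R => t + c)%R = cst 1%R.
Proof.
apply/funext => t; rewrite derive1E; apply: derive_val.
by apply: is_derive_eq; rewrite addr0.
Qed.

Lemma integral_translation (a b c : R) (g : R -> R) : (a <= b)%R -> continuous g ->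
  \int[mu]_(t in `[(a + c)%R, (b + c)%R]) (g t)%:E =
  \int[mu]_(t in `[a, b]) (g (t + c)%R)%:E.
Proof.
move=> ab cg.
have := @integration_by_substitution_increasing R (fun t => t + c)%R g a b ab.
have dc := derive1_shiftr c; rewrite /= in dc *.
move=> -> //.
- by apply: eq_integral => t _; rewrite !fctE dc mulr1.
- by move=> x y _ _ xy; rewrite ltrD2r.
- by rewrite dc => x _; exact: cvg_cst.
- by rewrite dc; exact: is_cvg_cst.
- by rewrite dc; exact: is_cvg_cst.
- split => //=.
  + by apply: cvg_at_right_filter; apply: cvgD => //; exact: cvg_cst.
  + by apply: cvg_at_left_filter; apply: cvgD => //; exact: cvg_cst.
- by apply: continuous_subspaceT.
Qed.

(** The half-open translates of [[-A, A[] by multiples of 2A tile the line, so at each point exactly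
    one term of the sum of restrictions survives. The missing endpoint is a null set and is restored
    at the end. *)
Lemma integral_unfold (A : R) (g : R -> R) : (0 < A)%R -> continuous g ->
  (forall t, (0 <= g t)%R) ->
  \int[mu]_t (g t)%:E =
  \esum_(k in [set: int]) \int[mu]_(t in `[(- A)%R, A]) (g (t + 2 * A * k%:~R)%R)%:E.
Proof.
move=> A0 cg g0.
pose J (k : int) : set R := [set` `[(- A + 2 * A * k%:~R)%R, (A + 2 * A * k%:~R)%R[%R].
have mg : measurable_fun setT (EFin \o g).
  by apply/measurable_EFinP; exact: continuous_measurable_fun.
have mJ k : measurable (J k) by exact: measurable_itv.
transitivity (\int[mu]_t (\esum_(k in [set: int]) ((EFin \o g) \_ (J k)) t)).
  apply: eq_integral => t _.
  pose k := Num.floor ((t + A) / (2 * A))%R.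
  have kt : J k t.
    have := floor_itv ((t + A) / (2 * A))%R; rewrite -/k.
    rewrite ler_pdivlMr ?mulr_gt0// ltr_pdivrMr ?mulr_gt0// intrD => /andP[k1 k2].
    by rewrite /J/= in_itv/=; apply/andP; split; nra.
  rewrite (@esum_support1 _ _ k)//.
  - by rewrite patchE mem_set.
  - by move=> j _; apply: erestrict_ge0 => s _; rewrite lee_fin.
  - move=> j _ jk; rewrite patchE memNset// /J/= in_itv/= => /andP[j1 j2].
    move: kt; rewrite /J/= in_itv/= => /andP[k1 k2]; apply: jk.
    (* If two tiles meet, the left end of each lies below the right end of the other; this gives
       both inequalities between the indices. *)
    have lt_inj (m n : int) : (- A + 2 * A * m%:~R < A + 2 * A * n%:~R)%R -> (m <= n)%R.
      move=> h; rewrite -ltzD1 -(ltr_int R) intrD.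
      rewrite -(@ltr_pM2l _ (2 * A)%R) ?mulr_gt0//; lra.
    by apply/eqP; rewrite eq_le !lt_inj// ?(le_lt_trans j1)// (le_lt_trans k1).
rewrite integral_esum//.
- apply: eq_esum => k _; rewrite -integral_mkcond integral_itv_bndo_bndc.
    by rewrite -integral_translation// ge0_cp ?ltW.
  exact: measurable_funTS.
- exact: countableP.
- by move=> k _; apply: (measurable_restrictT _ (mJ k)).1; exact: measurable_funTS.
- by move=> k t _ _; apply: erestrict_ge0 => s _; rewrite lee_fin.
Qed.

End Unfolding.

(** * Integrating a sum over a family on which translations act *)

Section UnfoldSum.
Context {R : realType} (T : choiceType).
Local Notation mu := (@lebesgue_measure R).
Local Open Scope ereal_scope.
Variables (X S : set T) (e : T * int -> T) (f : T -> R -> R) (A : R) (M : T -> R).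
Hypotheses (cX : countable X) (A0 : (0 < A)%R)
  (eX : set_bij (S `*` [set: int]) X e)
  (cf : forall x, continuous (f x))
  (fe : forall s k t, S s -> f (e (s, k)) t = f s (t + 2 * A * k%:~R)%R)
  (fM : forall x t, X x -> t \in `[(- A)%R, A] -> (`|f x t| <= M x)%R)
  (Mfin : \esum_(x in X) (M x)%:E < +oo).

Let mhf (h : R -> R) (D : set R) x : continuous h ->
  measurable_fun D (fun t => (h (f x t))%:E).
Proof.
move=> ch; apply/measurable_funTS/measurable_EFinP.
apply: continuous_measurable_fun => t.
by apply: continuous_comp; [exact: cf|exact: ch].
Qed.

(** The outer function [h] will be the absolute value, the positive part and the negative part,
    which thus share one application of Tonelli. *)
Let unfold (h : R -> R) : continuous h -> (forall y, (0 <= h y)%R) ->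
  \int[mu]_(t in `[(- A)%R, A]) (\esum_(x in X) (h (f x t))%:E) =
  \esum_(s in S) \int[mu]_t (h (f s t))%:E.
Proof.
move=> ch h0.
have chf x : continuous (h \o f x).
  by move=> t; apply: continuous_comp; [exact: cf|exact: ch].
rewrite integral_esum//; last 2 first.
- by move=> x _; exact: mhf.
- by move=> x t _ _; rewrite lee_fin.
rewrite (reindex_esum _ _ _ _ eX)//.
pose a s k := \int[mu]_(t in `[(- A)%R, A]) (h (f (e (s, k)) t))%:E.
transitivity (\esum_(z in S `*`` (fun=> [set: int])) a z.1 z.2).
  by apply: eq_esum => -[].
rewrite -esum_esum; last first.
  by move=> s k _ _; apply: integral_ge0 => t _; rewrite lee_fin.
apply: eq_esum => s Ss; rewrite (@integral_unfold _ A (h \o f s))//=.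
by apply: eq_esum => k _; apply: eq_integral => t _; rewrite fe.
Qed.

Let abs_fin t : t \in `[(- A)%R, A] -> \esum_(x in X) (`|f x t|%R)%:E < +oo.
Proof.
by move=> tA; apply: le_lt_trans Mfin; apply: le_esum => x Xx; rewrite lee_fin fM.
Qed.

(** Read backwards, the unfolding identity turns this sum of norms over the line into an integral
    over [[-A, A]], where the majorant bounds it by 2A times a finite sum. *)
Lemma summable_unfold : \esum_(s in S) \int[mu]_t (`|f s t|%R)%:E < +oo.
Proof.
rewrite -(@unfold Num.norm)//; last exact: norm_continuous.
apply: (@le_lt_trans _ _ (\int[mu]_(t in `[(- A)%R, A]) \esum_(x in X) (M x)%:E)).
  apply: ge0_le_integral => //.
  - by move=> t _; apply: esum_ge0 => x _; rewrite lee_fin.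
  - apply: measurable_esum => //.
    by move=> x _; apply: mhf; exact: norm_continuous.
  - by move=> t tA; apply: le_esum => x Xx; rewrite lee_fin fM.
have M0 : 0 <= \esum_(x in X) (M x)%:E.
  apply: esum_ge0 => x Xx; rewrite lee_fin (le_trans (normr_ge0 (f x 0)))// fM//.
  by rewrite in_itv/= oppr_le0 ltW.
rewrite -(@fineK _ (\esum_(x in X) (M x)%:E)) ?ge0_fin_numE//.
rewrite integral_cst//= lebesgue_measure_itv/=.
by case: ifP => _; rewrite ?mule0// -EFinB -EFinM ltry.
Qed.

Let cont_pos : continuous (fun y : R => Num.max y 0)%R.
Proof. by move=> y; apply: continuous_max; [exact: cvg_id|exact: cvg_cst]. Qed.

Let cont_neg : continuous (fun y : R => Num.max (- y) 0)%R.
Proof.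
by move=> y; apply: continuous_max; [exact: continuousN|exact: cvg_cst].
Qed.

Let part_lty (h : R -> R) : continuous h -> (forall y, (0 <= h y <= `|y|)%R) ->
  [/\ forall t, t \in `[(- A)%R, A] -> \esum_(x in X) (h (f x t))%:E < +oo,
      \esum_(s in S) \int[mu]_t (h (f s t))%:E < +oo &
      mu.-integrable `[(- A)%R, A] (fun t => \esum_(x in X) (h (f x t))%:E)].
Proof.
move=> ch h0; have h0' y : (0 <= h y)%R by case/andP: (h0 y).
have hS : \esum_(s in S) \int[mu]_t (h (f s t))%:E < +oo.
  apply: le_lt_trans summable_unfold; apply: le_esum => s Ss.
  apply: ge0_le_integral => //.
  - by move=> t _; rewrite lee_fin.
  - exact: mhf.
  - by apply: mhf; exact: norm_continuous.
  - by move=> t _; rewrite lee_fin; case/andP: (h0 (f s t)).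
split=> //.
- move=> t /abs_fin; apply: le_lt_trans; apply: le_esum => x _.
  by rewrite lee_fin; case/andP: (h0 (f x t)).
- apply/integrableP; split.
    apply: measurable_esum => [//|//|x _|x t _ _]; first exact: mhf.
    by rewrite lee_fin h0'.
  move: hS; rewrite -unfold//; apply: le_lt_trans.
  rewrite le_eqVlt; apply/orP; left; apply/eqP; apply: eq_integral => t _.
  by rewrite gee0_abs// esum_ge0// => x _; rewrite lee_fin.
Qed.

(** The norm of [f s] is a single term of the finite sum in [summable_unfold]. *)
Lemma integrable_orbit s : S s -> mu.-integrable setT (EFin \o f s).
Proof.
move=> Ss; apply/integrableP; split.
  by apply: (@mhf id) => y; exact: cvg_id.
have int0 x : 0 <= \int[mu]_t (`|f x t|%R)%:E.
  by apply: integral_ge0 => t _; rewrite lee_fin.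
apply: le_lt_trans summable_unfold.
rewrite (esumID [set s])//.
by rewrite setI1 mem_set// esum_set1 ?leeDl ?esum_ge0.
Qed.

Lemma integral_rsum_unfold :
  mu.-integrable `[(- A)%R, A] (EFin \o (fun t => rsum X (f ^~ t))) /\
  (\int[mu]_(t in `[- A, A]) rsum X (f ^~ t) = rsum S (fun s => \int[mu]_t f s t))%R.
Proof.
have [|p1 p2 p3] := part_lty cont_pos.
  by move=> y; rewrite le_max lexx orbT ge_max normr_ge0 ler_norm.
have [|n1 n2 n3] := part_lty cont_neg.
  by move=> y; rewrite le_max lexx orbT ge_max normr_ge0 -normrN ler_norm.
pose P t := \esum_(x in X) (Num.max (f x t) 0%R)%:E.
pose N t := \esum_(x in X) (Num.max (- f x t)%R 0%R)%:E.
have max0 (y : R) : (0 <= Num.max y 0)%R by rewrite le_max lexx orbT.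
have Pfin t : t \in `[(- A)%R, A] -> P t \is a fin_num.
  by move=> /p1; rewrite ge0_fin_numE// esum_ge0// => x _; rewrite lee_fin.
have Nfin t : t \in `[(- A)%R, A] -> N t \is a fin_num.
  by move=> /n1; rewrite ge0_fin_numE// esum_ge0// => x _; rewrite lee_fin.
have rE : {in `[(- A)%R, A]%classic, (P \- N) =1 EFin \o (fun t => rsum X (f ^~ t))}.
  move=> t /set_mem/= tA; rewrite /rsum /= EFinB !fineK//.
    exact: Nfin.
  exact: Pfin.
have iPN : mu.-integrable `[(- A)%R, A] (P \- N) by exact: integrableB.
split; first by apply: (@eq_integrable _ _ R mu) rE iPN.
transitivity (fine (\int[mu]_(t in `[(- A)%R, A]) (P \- N) t)).
  by congr fine; apply: eq_integral => t tA; rewrite rE.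
rewrite integralB//.
rewrite /P /N (@unfold (fun y => Num.max y 0)%R)// (@unfold (fun y => Num.max (- y) 0)%R)//.
have intE s : S s -> (\int[mu]_t f s t =
    fine (\int[mu]_t (Num.max (f s t) 0%R)%:E) - fine (\int[mu]_t (Num.max (- f s t)%R 0%R)%:E))%R.
  move=> Ss; have fs := integrable_orbit Ss.
  rewrite /Rintegral integralE fineB; last 2 first.
  - exact: integrable_pos_fin_num.
  - exact: integrable_neg_fin_num.
  by rewrite (funerpos (f s)) (funerneg (f s)).
rewrite [RHS](_ : _ = rsum S (fun s => fine (\int[mu]_t (Num.max (f s t) 0%R)%:E) -
    fine (\int[mu]_t (Num.max (- f s t)%R 0%R)%:E))%R); last first.
  rewrite /rsum; congr (fine _ - fine _)%R; apply: eq_esum => s Ss.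
    by rewrite /funrpos intE.
  by rewrite /funrneg intE.
have fin_part (h : R -> R) s : (forall y, (0 <= h y <= `|y|)%R) ->
    continuous h -> S s -> \int[mu]_t (h (f s t))%:E \is a fin_num.
  move=> h0 ch Ss; rewrite ge0_fin_numE; last first.
    by apply: integral_ge0 => t _; rewrite lee_fin; case/andP: (h0 (f s t)).
  have [_ + _] := part_lty ch h0; apply: le_lt_trans.
  have int0 x : 0 <= \int[mu]_t (h (f x t))%:E.
    by apply: integral_ge0 => t _; rewrite lee_fin; case/andP: (h0 (f x t)).
  rewrite (esumID [set s])//.
  by rewrite setI1 mem_set// esum_set1 ?leeDl ?esum_ge0.
have EP : \esum_(s in S) (fine (\int[mu]_t (Num.max (f s t) 0%R)%:E))%:E =
    \esum_(s in S) \int[mu]_t (Num.max (f s t) 0%R)%:E.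
  apply: eq_esum => s Ss; rewrite fineK//.
  apply: (fin_part (fun y => Num.max y 0%R)) => // y.
  by rewrite max0/= ge_max normr_ge0 ler_norm.
have EN : \esum_(s in S) (fine (\int[mu]_t (Num.max (- f s t)%R 0%R)%:E))%:E =
    \esum_(s in S) \int[mu]_t (Num.max (- f s t)%R 0%R)%:E.
  apply: eq_esum => s Ss; rewrite fineK//.
  apply: (fin_part (fun y => Num.max (- y)%R 0%R)) => // y.
  by rewrite max0/= ge_max normr_ge0 -normrN ler_norm.
(* The positive part of an integral is in general not the integral of the positive part, so the sum
   over [S] is evaluated through this other decomposition. *)
rewrite rsumE ?EP ?EN//.
- rewrite fineB// ge0_fin_numE ?esum_ge0// => s Ss; apply: integral_ge0 => t _.
    by rewrite lee_fin.
  by rewrite lee_fin.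
- by move=> s _; rewrite fine_ge0// integral_ge0// => t _; rewrite lee_fin.
- by move=> s _; rewrite fine_ge0// integral_ge0// => t _; rewrite lee_fin.
Qed.

End UnfoldSum.

(** * Gaussian integrals with a complex parameter *)

Section LineIntegral.
Context {R : realType}.
Local Notation mu := (@lebesgue_measure R).

(** The integrals over [[-n, n]] converge to the integral over the line by domination by [|f|], and
    to [l2 - l1] by the fundamental theorem of calculus. Limits along the integers suffice because
    integrability is assumed. *)
Lemma integral_line (f F : R -> R) (l1 l2 : R) : continuous f ->
  mu.-integrable setT (EFin \o f) -> (forall x : R, is_derive x 1 F (f x)) ->
  F n%:R @[n --> \oo] --> l2 -> F (- n%:R) @[n --> \oo] --> l1 ->
  \int[mu]_x f x = l2 - l1.
Proof.
move=> cf intf dF F2 F1.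
have mf : measurable_fun setT (EFin \o f).
  by apply/measurable_EFinP; exact: continuous_measurable_fun.
pose J (n : nat) : set R := [set` `[- n%:R, n%:R]%R].
have mJ n : measurable (J n) by exact: measurable_itv.
have h1 : (\int[mu]_(x in J n) (f x)%:E @[n --> \oo] --> \int[mu]_x (f x)%:E)%E.
  under eq_fun do rewrite integral_mkcond.
  apply: (@dominated_cvg _ _ R mu setT measurableT _ _ (abse \o (EFin \o f))).
  - by move=> n; apply: (measurable_restrictT _ (mJ n)).1; exact: measurable_funTS.
  - move=> x _; apply: cvg_near_cst; near=> n.
    rewrite patchE mem_set// /J/= in_itv/= -ler_norml.
    by near: n; exact: nbhs_infty_ger.
  - by [].
  - exact: integrable_abse.
  - move=> n x _ /=; rewrite patchE; case: ifP => _ //=; by rewrite normr0 lee_fin.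
have h2 : (\int[mu]_(x in J n) (f x)%:E @[n --> \oo] --> (l2 - l1)%:E)%E.
  have h3 : ((F n%:R - F (- n%:R))%:E @[n --> \oo] --> (l2 - l1)%:E)%E.
    by apply: cvg_EFin; [exact: nearW|exact: cvgB].
  apply: cvg_trans h3.
    apply: near_eq_cvg; near=> n => /=.
    have n0 : (0 < n)%N by near: n; exact: nbhs_infty_gt.
    rewrite (@continuous_FTC2 _ f F)//.
    + by rewrite -subr_gt0 opprK addr_gt0// ltr0n.
    + exact: continuous_subspaceT.
    + have cF : continuous F.
        move=> x; apply/differentiable_continuous/derivable1_diffP.
        exact: @ex_derive _ _ _ _ _ _ _ (dF x).
      split=> [x _||]; [exact: @ex_derive _ _ _ _ _ _ _ (dF x)
        |exact/cvg_at_right_filter/cF|exact/cvg_at_left_filter/cF].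
    + by move=> x _; rewrite derive1E; exact: @derive_val _ _ _ _ _ _ _ (dF x).
by rewrite /Rintegral (cvg_unique _ h1 h2).
Unshelve. all: by end_near. Qed.
End LineIntegral.

Section DerivativeRules.
Context {R : realType}.
Implicit Types (f g : R -> R) (x : R).

(** In these rules the derivative [d] is tied to the computed one by an equation, so that rules nest
    with [erefl] and only the outermost equation is left to [ring]. *)
Lemma derive_mul f g x df dg d : is_derive x (1:R) f df -> is_derive x (1:R) g dg ->
  d = df * g x + f x * dg -> is_derive x (1:R) (fun y => f y * g y) d.
Proof.
move=> hf hg ->; apply: (is_derive_eq (is_deriveM hf hg)).
by rewrite /GRing.scale/= addrC; congr (_ + _); rewrite mulrC.
Qed.

Lemma derive_comp f g x df dg d : is_derive (g x) (1:R) f df ->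
  is_derive x (1:R) g dg -> d = df * dg -> is_derive x (1:R) (fun y => f (g y)) d.
Proof. by move=> hf hg ->; exact: is_derive1_comp. Qed.

Lemma derive_scale f c x df d : is_derive x (1:R) f df ->
  d = c * df -> is_derive x (1:R) (fun y => c * f y) d.
Proof. by move=> hf ->; exact: is_deriveZ. Qed.

Lemma derive_add f g x df dg d : is_derive x (1:R) f df -> is_derive x (1:R) g dg ->
  d = df + dg -> is_derive x (1:R) (fun y => f y + g y) d.
Proof. by move=> hf hg ->; exact: is_deriveD. Qed.

Lemma derive_mulr (k : R) x : is_derive x (1:R) (fun y => y * k) k.
Proof.
apply: (derive_mul (g := cst k) (is_derive_id _ _) (is_derive_cst k _ _)).
by rewrite mul1r mulr0 addr0.
Qed.

Lemma derive_sqr x : is_derive x (1:R) (fun y => y ^+ 2) (2 * x).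
Proof.
apply: (derive_mul (f := id) (g := id) (is_derive_id _ _) (is_derive_id _ _)).
by rewrite mulr1 mul1r mulr_natl mulr2n.
Qed.

Lemma is_derive_continuous f (df : R -> R) :
  (forall x, is_derive x (1:R) f (df x)) -> continuous f.
Proof.
move=> h x; apply/differentiable_continuous/derivable1_diffP.
exact: @ex_derive _ _ _ _ _ _ _ (h x).
Qed.

End DerivativeRules.

Section Gauss.
Context {R : realType}.
Local Notation mu := (@lebesgue_measure R).
Variable a : R.
Hypothesis a0 : 0 < a.

(** With [gauss_sin], the real and imaginary parts of e^((-a + ib) q^2). The kernel e^(pi i v q^2)
    is the case a = pi Im v, b = pi Re v. *)
Definition gauss_cos (b q : R) : R := expR (- a * q ^+ 2) * cos (b * q ^+ 2).
Definition gauss_sin (b q : R) : R := expR (- a * q ^+ 2) * sin (b * q ^+ 2).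

(** Up to a constant this is the normal density of mean 0 and variance 1/(2c), which has integral
    1. *)
Lemma integrable_gauss (c : R) : 0 < c ->
  mu.-integrable setT (EFin \o (fun x => expR (- c * x ^+ 2))) /\
  \int[mu]_x expR (- c * x ^+ 2) = Num.sqrt (pi / c).
Proof.
move=> c0.
pose s := Num.sqrt (c *+ 2)^-1.
have s2 : s ^+ 2 = (c *+ 2)^-1 by rewrite sqr_sqrtr// invr_ge0 mulrn_wge0// ltW.
have sn0 : s != 0.
  by rewrite gt_eqF// sqrtr_gt0 invr_gt0 mulrn_wgt0.
have pk0 : normal_peak s != 0 by rewrite gt_eqF// normal_peak_gt0.
have E : (fun x => expR (- c * x ^+ 2)) = (fun x => (normal_peak s)^-1 * normal_pdf 0 s x).
  apply/funext => x; rewrite normal_pdfE//= mulKf// /normal_fun s2 subr0; congr expR.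
  by rewrite -[c *+ 2]mulr_natr; field; rewrite gt_eqF.
have intn := @integrable_normal_pdf R 0 s.
split.
  rewrite E (_ : EFin \o _ = fun x => (((normal_peak s)^-1)%:E * (normal_pdf 0 s x)%:E)%E)//.
  exact: integrableZl.
rewrite E RintegralZl// /Rintegral integral_normal_pdf mulr1 /normal_peak invrK.
congr Num.sqrt; rewrite s2 -mulr_natr; field.
by rewrite gt_eqF.
Qed.

Lemma derive_gauss_exp (q : R) :
  is_derive q (1:R) (fun q => expR (- a * q ^+ 2)) (- 2 * a * q * expR (- a * q ^+ 2)).
Proof.
refine (derive_comp (is_derive_expR _) (derive_scale (derive_sqr q) erefl) _).
by rewrite /=; ring.
Qed.

Lemma derive_gauss_cos b q : is_derive q (1:R) (gauss_cos b)
  (- 2 * a * q * gauss_cos b q - 2 * b * q * gauss_sin b q).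
Proof.
refine (derive_mul (derive_gauss_exp q) (derive_comp (is_derive_cos _)
  (derive_scale (derive_sqr q) erefl) erefl) _).
by rewrite /gauss_cos /gauss_sin; ring.
Qed.

Lemma derive_gauss_sin b q : is_derive q (1:R) (gauss_sin b)
  (- 2 * a * q * gauss_sin b q + 2 * b * q * gauss_cos b q).
Proof.
refine (derive_mul (derive_gauss_exp q) (derive_comp (is_derive_sin _)
  (derive_scale (derive_sqr q) erefl) erefl) _).
by rewrite /gauss_cos /gauss_sin; ring.
Qed.

Lemma continuous_gauss_cos b : continuous (gauss_cos b).
Proof. exact: is_derive_continuous (derive_gauss_cos b). Qed.

Lemma continuous_gauss_sin b : continuous (gauss_sin b).
Proof. exact: is_derive_continuous (derive_gauss_sin b). Qed.

Lemma gauss_cos_le b q : `|gauss_cos b q| <= expR (- a * q ^+ 2).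
Proof.
rewrite normrM ger0_norm ?expR_ge0// ler_piMr ?expR_ge0//.
by rewrite ler_norml cos_geN1 cos_le1.
Qed.

Lemma gauss_sin_le b q : `|gauss_sin b q| <= expR (- a * q ^+ 2).
Proof.
rewrite normrM ger0_norm ?expR_ge0// ler_piMr ?expR_ge0//.
by rewrite ler_norml sin_geN1 sin_le1.
Qed.

(** Half of the exponent absorbs the square: y e^(-y) <= 1 for y = a q^2 / 2. The bound serves for
    domination under the integral sign and for boundary terms. *)
Lemma sqr_gauss_le q : q ^+ 2 * expR (- a * q ^+ 2) <= (2 / a) * expR (- (a / 2) * q ^+ 2).
Proof.
have -> : - a * q ^+ 2 = - (a / 2) * q ^+ 2 + (- (a / 2) * q ^+ 2) by field.
rewrite expRD mulrA ler_wpM2r ?expR_ge0//.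
rewrite mulNr expRN ler_pdivrMr ?expR_gt0// mulrC.
have := expR_ge1Dx ((a / 2) * q ^+ 2).
move=> h; apply: (@le_trans _ _ ((a / 2 * q ^+ 2) * (2 / a))).
  by rewrite le_eqVlt; apply/orP; left; apply/eqP; field; rewrite gt_eqF.
by rewrite ler_wpM2r ?divr_ge0// ?ltW//; lra.
Qed.

Lemma integrable_le (f g : R -> R) : continuous f -> (forall x, `|f x| <= g x) ->
  mu.-integrable setT (EFin \o g) -> mu.-integrable setT (EFin \o f).
Proof.
move=> cf fg; apply: (@le_integrable _ _ R mu) => //.
  by apply/measurable_EFinP; exact: continuous_measurable_fun.
by move=> x _; rewrite /= lee_fin (le_trans (fg x))// ler_norm.
Qed.

Lemma integrable_gauss_cos b : mu.-integrable setT (EFin \o gauss_cos b).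
Proof.
apply: integrable_le (integrable_gauss a0).1; first exact: continuous_gauss_cos.
exact: gauss_cos_le.
Qed.

Lemma integrable_gauss_sin b : mu.-integrable setT (EFin \o gauss_sin b).
Proof.
apply: integrable_le (integrable_gauss a0).1; first exact: continuous_gauss_sin.
exact: gauss_sin_le.
Qed.

Lemma integrable_sqr_gauss :
  mu.-integrable setT (EFin \o (fun q => q ^+ 2 * expR (- a * q ^+ 2))).
Proof.
apply: (integrable_le (g := fun q => (2 / a) * expR (- (a / 2) * q ^+ 2))).
- move=> x; apply: cvgM; last exact: is_derive_continuous derive_gauss_exp x.
  exact: is_derive_continuous derive_sqr x.
- move=> q; rewrite (ger0_norm (mulr_ge0 (sqr_ge0 q) (expR_ge0 _))).
  exact: sqr_gauss_le.
- have a20 : 0 < a / 2 by rewrite divr_gt0.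
  rewrite (_ : EFin \o _ = fun q => ((2 / a)%:E * (expR (- (a / 2) * q ^+ 2))%:E)%E)//.
  by apply: integrableZl => //; exact: (integrable_gauss a20).1.
Qed.

Lemma integrable_sqr_gauss_cos b : mu.-integrable setT (EFin \o (fun q => q ^+ 2 * gauss_cos b q)).
Proof.
apply: integrable_le integrable_sqr_gauss.
  move=> x; apply: cvgM; last exact: continuous_gauss_cos.
  exact: is_derive_continuous derive_sqr x.
by move=> q; rewrite normrM ger0_norm ?sqr_ge0// ler_wpM2l ?sqr_ge0// gauss_cos_le.
Qed.

Lemma integrable_sqr_gauss_sin b : mu.-integrable setT (EFin \o (fun q => q ^+ 2 * gauss_sin b q)).
Proof.
apply: integrable_le integrable_sqr_gauss.
  move=> x; apply: cvgM; last exact: continuous_gauss_sin.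
  exact: is_derive_continuous derive_sqr x.
by move=> q; rewrite normrM ger0_norm ?sqr_ge0// ler_wpM2l ?sqr_ge0// gauss_sin_le.
Qed.

End Gauss.

Section GaussComplex.
Context {R : realType}.
Local Notation mu := (@lebesgue_measure R).
Variable a : R.
Hypothesis a0 : 0 < a.

Local Notation C b := (\int[mu]_q gauss_cos a b q).
Local Notation S b := (\int[mu]_q gauss_sin a b q).
Local Notation C2 b := (\int[mu]_q (q ^+ 2 * gauss_cos a b q)).
Local Notation S2 b := (\int[mu]_q (q ^+ 2 * gauss_sin a b q)).

Lemma derive_under_integral (f df : R -> R -> R) (G : R -> R) (b : R) :
  (forall c, mu.-integrable setT (EFin \o f c)) ->
  (forall c q, is_derive c (1:R) (f ^~ q) (df c q)) ->
  (forall q, 0 <= G q) -> mu.-integrable setT (EFin \o G) ->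
  (forall c q, `|df c q| <= G q) ->
  is_derive b (1:R) (fun c => \int[mu]_q f c q) (\int[mu]_q df b q).
Proof.
move=> intf derf G0 intG dfG.
(* The radius 1 is arbitrary, as the bound [G] is uniform in the parameter. *)
have bI : [set` `]b - 1, b + 1[%R] b by rewrite /= in_itv/= ltrBlDr ltrDl ltr01/=.
have pE c q : partial1of2 f c q = df c q.
  by rewrite partial1of2E; apply: (@derive_val _ _ _ _ _ _ _ (derf c q)).
have dv c q : derivable (f ^~ q) c 1 by apply: (@ex_derive _ _ _ _ _ _ _ (derf c q)).
have H1 := @derivable_under_integral R _ _ mu f setT measurableT b (b - 1) (b + 1) bI
  (fun c _ => intf c) (fun c q _ _ => dv c q) G G0 intG.
have H2 := @differentiation_under_integral R _ _ mu f setT measurableT b (b - 1) (b + 1) bI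
  (fun c _ => intf c) (fun c q _ _ => dv c q) G G0 intG.
apply: DeriveDef; first by apply: H1 => c q _ _; rewrite pE.
rewrite -derive1E H2; last by move=> c q _ _; rewrite pE.
by apply: eq_Rintegral => q _; rewrite /= pE.
Qed.

Lemma derive_integral_gauss_cos b : is_derive b (1:R) (fun b => C b) (- S2 b).
Proof.
have -> : - S2 b = \int[mu]_q (-1 * (q ^+ 2 * gauss_sin a b q)).
  rewrite RintegralZl ?mulN1r//; exact: integrable_sqr_gauss_sin.
apply: (derive_under_integral (G := fun q => q ^+ 2 * expR (- a * q ^+ 2))
  (df := fun b q => -1 * (q ^+ 2 * gauss_sin a b q))).
- by move=> c; exact: integrable_gauss_cos.
- move=> c q; refine (derive_scale (derive_comp (is_derive_cos _)
     (derive_mulr (q ^+ 2) c) erefl) _).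
  by rewrite /gauss_sin/=; ring.
- by move=> q; rewrite mulr_ge0 ?sqr_ge0 ?expR_ge0.
- exact: integrable_sqr_gauss.
- move=> c q; rewrite mulN1r normrN normrM ger0_norm ?sqr_ge0// ler_wpM2l ?sqr_ge0//.
  exact: gauss_sin_le.
Qed.

Lemma derive_integral_gauss_sin b : is_derive b (1:R) (fun b => S b) (C2 b).
Proof.
apply: (derive_under_integral (G := fun q => q ^+ 2 * expR (- a * q ^+ 2))
  (df := fun b q => q ^+ 2 * gauss_cos a b q)).
- by move=> c; exact: integrable_gauss_sin.
- move=> c q; refine (derive_scale (derive_comp (is_derive_sin _)
     (derive_mulr (q ^+ 2) c) erefl) _).
  by rewrite /gauss_cos/=; ring.
- by move=> q; rewrite mulr_ge0 ?sqr_ge0 ?expR_ge0.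
- exact: integrable_sqr_gauss.
- move=> c q; rewrite normrM ger0_norm ?sqr_ge0// ler_wpM2l ?sqr_ge0//.
  exact: gauss_cos_le.
Qed.

(** By [sqr_gauss_le] the product is at most (2/a)/|u n|. The condition on [u] covers n and -n at
    once, and the index is shifted by one to avoid dividing by 0. *)
Lemma cvg_mul_gauss (f : R -> R) (u : nat -> R) :
  (forall q, `|f q| <= expR (- a * q ^+ 2)) -> (forall n, `|u n| = n%:R) ->
  u n * f (u n) @[n --> \oo] --> (0:R).
Proof.
move=> fle un.
have h : (2 / a) * harmonic n @[n --> \oo] --> (2 / a) * (0 : R).
  by apply: cvgM; [exact: cvg_cst|exact: cvg_harmonic].
rewrite mulr0 in h.
rewrite -cvg_shiftS.
apply/norm_cvg0P; apply: (squeeze_cvgr _ (cvg_cst 0) h); apply: nearW => n.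
rewrite normr_ge0/= /harmonic/=.
have n0 : 0 < n.+1%:R :> R by rewrite ltr0n.
rewrite ler_pdivlMr// normrM.
apply: (@le_trans _ _ (`|u n.+1| * expR (- a * u n.+1 ^+ 2) * n.+1%:R)).
  by rewrite ler_wpM2r ?(ltW n0)// ler_wpM2l.
rewrite -(un n.+1) mulrAC -normrM ger0_norm ?sqr_ge0 -?expr2 ?sqr_ge0//.
apply: le_trans (sqr_gauss_le a0 _) _.
apply: ler_piMr; first by rewrite divr_ge0// ltW.
rewrite -[leRHS]expR0 ler_expR.
by rewrite mulNr oppr_le0 mulr_ge0 ?sqr_ge0 ?divr_ge0 ?ltW.
Qed.

(** The integrand is the derivative of q g(q), which tends to 0 at both ends. Cosine and sine are
    the cases c = -b and c = b. *)
Lemma gauss_parts (g h : R -> R) (c : R) :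
  continuous g -> continuous h ->
  (forall q, `|g q| <= expR (- a * q ^+ 2)) ->
  (forall q, is_derive q (1:R) g (- 2 * a * q * g q + 2 * c * q * h q)) ->
  mu.-integrable setT (EFin \o g) ->
  mu.-integrable setT (EFin \o (fun q => q ^+ 2 * g q)) ->
  mu.-integrable setT (EFin \o (fun q => q ^+ 2 * h q)) ->
  \int[mu]_q g q - 2 * a * \int[mu]_q (q ^+ 2 * g q) +
  2 * c * \int[mu]_q (q ^+ 2 * h q) = 0.
Proof.
move=> cg ch gle dg i1 i2 i3.
pose f q := g q - 2 * a * (q ^+ 2 * g q) + 2 * c * (q ^+ 2 * h q).
have j2 : mu.-integrable setT (EFin \o (fun q => 2 * a * (q ^+ 2 * g q))).
  by under [_ \o _]eq_fun do rewrite /= EFinM; exact: integrableZl.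
have j3 : mu.-integrable setT (EFin \o (fun q => 2 * c * (q ^+ 2 * h q))).
  by under [_ \o _]eq_fun do rewrite /= EFinM; exact: integrableZl.
have j12 : mu.-integrable setT (EFin \o (fun q => g q - 2 * a * (q ^+ 2 * g q))).
  by under [_ \o _]eq_fun do rewrite /= EFinB; exact: integrableB.
transitivity (\int[mu]_q f q).
  by rewrite RintegralD// RintegralB// !RintegralZl.
rewrite -[RHS](subrr 0).
apply: (@integral_line _ f (fun q => q * g q)).
- have c2 (x : R) : {for x, continuous (fun y : R => y ^+ 2)}.
    exact: is_derive_continuous (@derive_sqr R) x.
  move=> x; apply: cvgD; first apply: cvgB; first exact: cg.
    by apply: cvgM; [exact: cvg_cst|apply: cvgM; [exact: c2|exact: cg]].
  by apply: cvgM; [exact: cvg_cst|apply: cvgM; [exact: c2|exact: ch]].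
- by rewrite /f; under [_ \o _]eq_fun do rewrite /= EFinD; exact: integrableD.
- move=> q; refine (derive_mul (is_derive_id _ _) (dg q) _).
  by rewrite /f/=; ring.
- by apply: cvg_mul_gauss => // n; rewrite ger0_norm.
- by apply: cvg_mul_gauss => // n; rewrite normrN ger0_norm.
Qed.

(** With [gauss_parts_sin], the real and imaginary parts of I = 2 (a - ib) I2, where I and I2 are
    the integrals of e^((-a + ib) q^2) and of q^2 e^((-a + ib) q^2). *)
Lemma gauss_parts_cos b : C b - 2 * a * C2 b - 2 * b * S2 b = 0.
Proof.
have dg q : is_derive q (1:R) (gauss_cos a b)
    (- 2 * a * q * gauss_cos a b q + 2 * (- b) * q * gauss_sin a b q).
  by apply: (is_derive_eq (derive_gauss_cos _ _ _)); ring.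
rewrite -[RHS](gauss_parts (@continuous_gauss_cos R a b)
  (@continuous_gauss_sin R a b) (@gauss_cos_le R a b) dg
  (integrable_gauss_cos a0 b) (integrable_sqr_gauss_cos a0 b)
  (integrable_sqr_gauss_sin a0 b)).
by ring.
Qed.

Lemma gauss_parts_sin b : S b - 2 * a * S2 b + 2 * b * C2 b = 0.
Proof.
apply: gauss_parts.
- exact: continuous_gauss_sin.
- exact: continuous_gauss_cos.
- exact: gauss_sin_le.
- exact: derive_gauss_sin.
- exact: integrable_gauss_sin.
- exact: integrable_sqr_gauss_sin.
- exact: integrable_sqr_gauss_cos.
Qed.

(* [c + is] squared times [a - ix] has derivative zero in [x]. *)
Lemma gauss_ode (c s c2 s2 : R -> R) :
  (forall x, c x - 2 * a * c2 x - 2 * x * s2 x = 0) ->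
  (forall x, s x - 2 * a * s2 x + 2 * x * c2 x = 0) ->
  (forall x, is_derive x (1:R) c (- s2 x)) ->
  (forall x, is_derive x (1:R) s (c2 x)) ->
  c 0 = Num.sqrt (pi / a) -> s 0 = 0 ->
  forall b, a * (c b ^+ 2 - s b ^+ 2) + 2 * b * (c b * s b) = pi /\
    2 * a * (c b * s b) - b * (c b ^+ 2 - s b ^+ 2) = 0.
Proof.
move=> P1 P2 dc ds c0 s0 b.
(* The real part [f] and the imaginary part [g] of this product, written in the shape that the rules
   of derivation produce. Their derivatives are combinations of [P1] and [P2]. *)
pose f x := a * (c x * c x + -1 * (s x * s x)) + x * 2 * (c x * s x).
pose g x := 2 * a * (c x * s x) + -1 * (x * (c x * c x + -1 * (s x * s x))).
have dcc x := derive_mul (dc x) (dc x) erefl.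
have dss x := derive_mul (ds x) (ds x) erefl.
have dcs x := derive_mul (dc x) (ds x) erefl.
have dm x := derive_add (dcc x) (derive_scale (c := -1) (dss x) erefl) erefl.
have df x : is_derive x (1:R) f 0.
  refine (derive_add (derive_scale (dm x) erefl)
    (derive_mul (derive_mulr 2 x) (dcs x) erefl) _).
  have := P1 x; have := P2 x => p2 p1; rewrite /=.
  transitivity (c x * (s x - 2 * a * s2 x + 2 * x * c2 x) + s x * (c x - 2 * a * c2 x - 2 * x * s2 x)).
    by rewrite p1 p2; ring.
  by ring.
have dg x : is_derive x (1:R) g 0.
  refine (derive_add (derive_scale (dcs x) erefl)
    (derive_scale (derive_mul (is_derive_id _ _) (dm x) erefl) erefl) _).
  have := P1 x; have := P2 x => p2 p1; rewrite /=.
  transitivity (s x * (s x - 2 * a * s2 x + 2 * x * c2 x) - c x * (c x - 2 * a * c2 x - 2 * x * s2 x)).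
    by rewrite p1 p2; ring.
  by ring.
split.
  transitivity (f b); first by rewrite /f; ring.
  rewrite (@is_derive_0_is_cst _ f b 0 df) /f c0 s0 -expr2 sqr_sqrtr ?divr_ge0 ?pi_ge0 ?ltW//.
  by field; rewrite gt_eqF.
transitivity (g b); first by rewrite /g; ring.
by rewrite (@is_derive_0_is_cst _ g b 0 dg) /g s0; ring.
Qed.

Lemma gauss_sqr b : a * (C b ^+ 2 - S b ^+ 2) + 2 * b * (C b * S b) = pi /\
  2 * a * (C b * S b) - b * (C b ^+ 2 - S b ^+ 2) = 0.
Proof.
apply: (gauss_ode gauss_parts_cos gauss_parts_sin derive_integral_gauss_cos
  derive_integral_gauss_sin).
  rewrite -(integrable_gauss a0).2; apply: eq_Rintegral => q _.
  by rewrite /gauss_cos mul0r cos0 mulr1.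
rewrite /Rintegral integral0_eq// => q _.
by rewrite /gauss_sin mul0r sin0 mulr0.
Qed.

(* The integral cannot vanish by [gauss_sqr], and it is positive at [b = 0]. *)
Lemma gauss_cos_gt0 b : 0 < C b.
Proof.
(* If the cosine integral vanished, the first identity would read -a S^2 = pi. *)
have Cn0 x : C x != 0.
  apply/eqP => Cx0; have [+ _] := gauss_sqr x; rewrite Cx0 mul0r mulr0 addr0 expr0n/= sub0r.
  move=> h; have := pi_gt0 R; rewrite -h mulrN oppr_gt0 ltNge mulr_ge0 ?sqr_ge0// ltW//.
have cC : continuous (fun b => C b) by exact: is_derive_continuous derive_integral_gauss_cos.
have C0 : 0 < C 0.
  rewrite (_ : C 0 = Num.sqrt (pi / a)) ?sqrtr_gt0 ?divr_gt0 ?pi_gt0//.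
  rewrite -(integrable_gauss a0).2; apply: eq_Rintegral => q _.
  by rewrite /gauss_cos mul0r cos0 mulr1.
rewrite ltNge; apply/negP => Cb.
have [b0|b0] := leP 0 b.
  have [||x _] := @IVT R (fun b => C b) 0 b 0 b0.
  - exact: continuous_subspaceT.
  - by rewrite ge_min le_max Cb (ltW C0) ?orbT.
  - by move/eqP; rewrite (negbTE (Cn0 x)).
have [||x _] := @IVT R (fun b => C b) b 0 0 (ltW b0).
- exact: continuous_subspaceT.
- by rewrite ge_min le_max Cb (ltW C0) ?orbT.
- by move/eqP; rewrite (negbTE (Cn0 x)).
Qed.

End GaussComplex.

(** * The integral over one orbit *)

Section Primitive.
Context {R : realType}.
Local Notation mu := (@lebesgue_measure R).

(** Based at -oo, so that the limits at -oo and +oo are 0 and the full integral. *)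
Definition primitive (g : R -> R) (x : R) : R := \int[mu]_(t in `]-oo, x]) g t.

Section primitive_of.
Variable g : R -> R.
Hypotheses (cg : continuous g) (ig : mu.-integrable setT (EFin \o g)).

Lemma derive_primitive x : is_derive x (1:R) (primitive g) (g x).
Proof.
have xx1 : x < x + 1 by rewrite ltrDl.
have ix : mu.-integrable `]-oo, x + 1] (EFin \o g) by exact: (integrableS measurableT).
have cgx : {for x, continuous g} by exact: cg.
have nx : (BInfty R true < BRight x)%E by rewrite ltNyr.
have [d e] := @continuous_FTC1 R g (BInfty _ true) x (x + 1) xx1 ix nx cgx.
apply: DeriveDef; first exact: d.
by rewrite -derive1E; exact: e.
Qed.

(** Dominated convergence for the indicators of the half-lines, which tend pointwise to 1 or to 0;
    the boolean handles both ends together. *)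
Lemma cvg_primitive (u : nat -> R) (b : bool) :
  (forall x, \forall n \near \oo, (x \in `]-oo, u n]) = b) ->
  primitive g (u n) @[n --> \oo] --> (if b then \int[mu]_x g x else 0).
Proof.
move=> ub.
have mg : measurable_fun setT (EFin \o g).
  by apply/measurable_EFinP; exact: continuous_measurable_fun.
pose J n : set R := [set` `]-oo, u n]].
have mJ n : measurable (J n) by exact: measurable_itv.
have h1 : (\int[mu]_(x in J n) (g x)%:E @[n --> \oo] -->
    \int[mu]_x (if b then (g x)%:E else 0%E))%E.
  under eq_fun do rewrite integral_mkcond.
  apply: (@dominated_cvg _ _ R mu setT measurableT _ _ (abse \o (EFin \o g))).
  - by move=> n; apply: (measurable_restrictT _ (mJ n)).1; exact: measurable_funTS.
  - move=> x _; apply: cvg_near_cst; near=> n.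
    rewrite patchE -(_ : (x \in J n) = b)//.
    rewrite mem_setE; near: n; exact: ub.
  - by [].
  - exact: integrable_abse.
  - by move=> n x _ /=; rewrite patchE; case: ifP => _ //=; rewrite normr0 lee_fin.
have -> : (if b then \int[mu]_x g x else 0) =
    fine (\int[mu]_x (if b then (g x)%:E else 0%E))%E.
  by case: b {ub h1} => //; rewrite integral0.
apply: fine_cvg; rewrite fineK//.
case: b {ub h1} => //; first exact: integrable_fin_num.
by rewrite integral0.
Unshelve. all: by end_near. Qed.

Lemma cvg_primitivey (u : nat -> R) : u n @[n --> \oo] --> +oo ->
  primitive g (u n) @[n --> \oo] --> \int[mu]_x g x.
Proof.
move=> uy; apply: (@cvg_primitive u true) => x; near=> n.
rewrite in_itv/=; near: n.
by have /cvgryPge := uy; apply.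
Unshelve. all: by end_near. Qed.

Lemma cvg_primitiveNy (u : nat -> R) : u n @[n --> \oo] --> -oo ->
  primitive g (u n) @[n --> \oo] --> (0 : R).
Proof.
move=> uy; apply: (@cvg_primitive u false) => x; near=> n.
rewrite in_itv/=; apply/negbTE; rewrite -ltNge; near: n.
by have /cvgrNyPlt := uy; apply.
Unshelve. all: by end_near. Qed.

End primitive_of.

Lemma cvgy_affine (u : nat -> R) (c d : R) : 0 < c ->
  (forall n, c * n%:R - d <= u n) -> u n @[n --> \oo] --> +oo.
Proof.
move=> c0 cu; apply/cvgryPge => M; near=> n.
apply: le_trans (cu n); rewrite lerBrDr -ler_pdivrMl//.
by near: n; exact: nbhs_infty_ger.
Unshelve. all: by end_near. Qed.

Lemma derive_expR_half (c x : R) :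
  is_derive x (1:R) (fun t => expR (t * c)) (c * expR (x * c)).
Proof.
refine (derive_comp (is_derive_expR _) (derive_mulr c x) _).
by rewrite mulrC.
Qed.

Lemma expR_half_ge (n : nat) : n%:R / 2 <= expR (n%:R * 2^-1 : R).
Proof. by apply: le_trans (expR_ge1Dx _); rewrite lerDr. Qed.

Lemma cvgy_exp_half (x y : R) : 0 < x ->
  x * expR (n%:R * 2^-1) + y * expR (- (n%:R * 2^-1)) @[n --> \oo] --> +oo.
Proof.
move=> x0; apply: (@cvgy_affine _ (x / 2) `|y|); first by rewrite divr_gt0.
move=> n; apply: lerD.
  by rewrite -mulrA ler_pM2l// mulrC expR_half_ge.
rewrite lerNl; apply: (le_trans (ler_norm _)); rewrite normrN.
rewrite normrM (ger0_norm (expR_ge0 _)) ler_piMr// -[leRHS]expR0 ler_expR.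
Qed.

Lemma cvgNy_exp_half (x y : R) : x < 0 ->
  x * expR (n%:R * 2^-1) + y * expR (- (n%:R * 2^-1)) @[n --> \oo] --> -oo.
Proof.
move=> x0; have nx0 : 0 < - x by rewrite oppr_gt0.
apply/cvgrNyPle => M.
have /cvgryPge/(_ (- M)) := @cvgy_exp_half (- x) (- y) nx0.
by apply: filterS => n; rewrite !mulNr -opprD lerN2.
Qed.

(* [f] is the derivative of [G \o q + H \o p], where [G] and [H] are primitives of
   [g] and [h]; [p] has the same limit at both ends, so [h] does not contribute. *)
Lemma integral_orbit (x y : R) (g h f : R -> R) :
  let p t := x * expR (t * 2^-1) + y * expR (- (t * 2^-1)) in
  let q t := x * expR (t * 2^-1) - y * expR (- (t * 2^-1)) in
  0 < x * y ->
  continuous g -> mu.-integrable setT (EFin \o g) ->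
  continuous h -> mu.-integrable setT (EFin \o h) ->
  (forall t, f t = p t / 2 * g (q t) + q t / 2 * h (p t)) ->
  mu.-integrable setT (EFin \o f) ->
  \int[mu]_t f t = Num.sg x * \int[mu]_t g t.
Proof.
move=> p q xy cg ig ch ih fE intf.
have dE (t : R) : is_derive t (1:R) (fun t => expR (- (t * 2^-1))) (- 2^-1 * expR (- (t * 2^-1))).
  rewrite (_ : (fun _ => _) = fun t => expR (t * - 2^-1)); last by apply/funext => u; rewrite mulrN.
  by rewrite -mulrN; exact: derive_expR_half.
have dp (t : R) : is_derive t (1:R) p (q t / 2).
  refine (derive_add (derive_scale (derive_expR_half _ t) erefl)
    (derive_scale (dE t) erefl) _).
  by rewrite /q; ring.
have dq (t : R) : is_derive t (1:R) q (p t / 2).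
  rewrite (_ : q = fun t => x * expR (t * 2^-1) + (- y) * expR (- (t * 2^-1))); last first.
    by apply/funext => u; rewrite /q mulNr.
  refine (derive_add (derive_scale (derive_expR_half _ t) erefl)
    (derive_scale (dE t) erefl) _).
  by rewrite /p; ring.
have cp := is_derive_continuous dp; have cq := is_derive_continuous dq.
have cf : continuous f.
  rewrite (_ : f = fun t => p t / 2 * g (q t) + q t / 2 * h (p t)); last exact/funext.
  move=> t; apply: cvgD; (apply: cvgM; first (apply: cvgM; [|exact: cvg_cst])).
  - exact: cp.
  - by apply: continuous_comp; [exact: cq|exact: cg].
  - exact: cq.
  - by apply: continuous_comp; [exact: cp|exact: ch].
pose F t := primitive g (q t) + primitive h (p t).
have dF (t : R) : is_derive t (1:R) F (f t).
  refine (derive_add (derive_comp (derive_primitive cg ig (q t)) (dq t) erefl)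
    (derive_comp (derive_primitive ch ih (p t)) (dp t) erefl) _).
  by rewrite fE; ring.
have pN (n : nat) : p (- n%:R) = y * expR (n%:R * 2^-1) + x * expR (- (n%:R * 2^-1)).
  by rewrite /p mulNr opprK addrC.
have qN (n : nat) : q (- n%:R) = - y * expR (n%:R * 2^-1) + x * expR (- (n%:R * 2^-1)).
  by rewrite /q mulNr opprK addrC mulNr.
have qP (n : nat) : q n%:R = x * expR (n%:R * 2^-1) + (- y) * expR (- (n%:R * 2^-1)).
  by rewrite /q mulNr.
(* As x and y have the same sign, [q] reverses its infinity between the two ends and [p] does not.
   For x < 0 both values of the primitive of [h] tend to 0; for x > 0 both tend to the integral of
   [h] and cancel. *)
have [x0|x0|x0] := ltgtP x 0; last by move: xy; rewrite x0 mul0r ltxx.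
- have y0 : y < 0 by rewrite -(nmulr_rgt0 _ x0).
  rewrite ltr0_sg// mulN1r -sub0r.
  rewrite -[X in X - _](addr0 0) -[X in _ - X]addr0.
  apply: (integral_line cf intf dF); apply: cvgD.
  + apply: (cvg_primitiveNy cg ig); under eq_fun do rewrite qP; exact: cvgNy_exp_half.
  + by apply: (cvg_primitiveNy ch ih); exact: cvgNy_exp_half.
  + apply: (cvg_primitivey cg ig); under eq_fun do rewrite qN; apply: cvgy_exp_half.
    by rewrite oppr_gt0.
  + apply: (cvg_primitiveNy ch ih); under eq_fun do rewrite pN; exact: cvgNy_exp_half.
- have y0 : 0 < y by rewrite -(pmulr_rgt0 _ x0).
  rewrite gtr0_sg// mul1r.
  have -> : \int[mu]_t g t = (\int[mu]_t g t + \int[mu]_t h t) - (0 + \int[mu]_t h t).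
    by rewrite add0r addrK.
  apply: (integral_line cf intf dF); apply: cvgD.
  + apply: (cvg_primitivey cg ig); under eq_fun do rewrite qP; exact: cvgy_exp_half.
  + by apply: (cvg_primitivey ch ih); exact: cvgy_exp_half.
  + apply: (cvg_primitiveNy cg ig); under eq_fun do rewrite qN; apply: cvgNy_exp_half.
    by rewrite oppr_lt0.
  + apply: (cvg_primitivey ch ih); under eq_fun do rewrite pN; exact: cvgy_exp_half.
Qed.

End Primitive.

Section ComplexOrbit.
Context {R : realType}.
Local Notation mu := (@lebesgue_measure R).
Local Notation Re := (@complex.Re R).
Local Notation Im := (@complex.Im R).
Implicit Types z w v : R[i].

Lemma Re_mul z w : Re (z * w) = Re z * Re w - Im z * Im w.
Proof. by case: z => ? ?; case: w. Qed.

Lemma Im_mul z w : Im (z * w) = Re z * Im w + Im z * Re w.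
Proof. by case: z => ? ?; case: w => ? ?. Qed.

Lemma Re_add z w : Re (z + w) = Re z + Re w.
Proof. by case: z => ? ?; case: w. Qed.

Lemma Im_add z w : Im (z + w) = Im z + Im w.
Proof. by case: z => ? ?; case: w. Qed.

Lemma Re_opp z : Re (- z) = - Re z.
Proof. by case: z. Qed.

Lemma Im_opp z : Im (- z) = - Im z.
Proof. by case: z. Qed.

Lemma complex_eq z w : Re z = Re w -> Im z = Im w -> z = w.
Proof. by case: z => ? ?; case: w => ? ? /= -> ->. Qed.

Lemma cexpE z : cexp z = (expR (Re z) * cos (Im z)) +i* (expR (Re z) * sin (Im z)).
Proof. by apply: complex_eq; rewrite /cexp ?Re_mul ?Im_mul/=; ring. Qed.

Lemma cexpD z w : cexp (z + w) = cexp z * cexp w.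
Proof.
rewrite /cexp Re_add Im_add expRD cosD sinD; apply: complex_eq; rewrite /= ?Re_mul ?Im_mul/=; ring.
Qed.

Lemma cexp0 : cexp (0 : R[i]) = 1.
Proof. by rewrite /cexp/= expR0 cos0 sin0 mul1r. Qed.

Definition cgauss v (q : R) : R[i] := cexp (pi%:C * 'i%C * v * (q ^+ 2)%:C).

Lemma cgaussE v q : cgauss v q =
  gauss_cos (pi * Im v) (pi * Re v) q +i* gauss_sin (pi * Im v) (pi * Re v) q.
Proof.
rewrite /cgauss cexpE /gauss_cos /gauss_sin !(Re_mul, Im_mul)/=.
by congr ((expR _ * cos _) +i* (expR _ * sin _)); ring.
Qed.

Lemma sqrtc_Re_gt0 z : 0 < Re z -> 0 < Re (sqrtc z).
Proof.
case: z => x y /= x0.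
rewrite sqrtr_gt0 divr_gt0// ltr_wpDl ?sqrtr_ge0//.
Qed.

(** By [gauss_sqr] the product has square 1. Were it r w = -1, then r |w|^2 would be minus the
    conjugate of w, which contradicts Re r > 0 and Re w > 0. *)
Lemma sqrtc_gauss v : 0 < Im v ->
  sqrtc (- 'i%C * v) * ((\int[mu]_q gauss_cos (pi * Im v) (pi * Re v) q) +i*
    (\int[mu]_q gauss_sin (pi * Im v) (pi * Re v) q)) = 1.
Proof.
move=> v0; set a := pi * Im v; set b := pi * Re v.
have a0 : 0 < a by rewrite mulr_gt0 ?pi_gt0.
have := gauss_cos_gt0 a0 b; have [] := gauss_sqr a0 b.
move: (\int[mu]_q gauss_cos a b q) (\int[mu]_q gauss_sin a b q) => c s e1 e2 c0.
have pi0 : pi != 0 :> R by rewrite gt_eqF ?pi_gt0.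
have f1 : Im v * (c ^+ 2 - s ^+ 2) + 2 * Re v * (c * s) = 1.
  by apply: (mulfI pi0); rewrite mulr1 -[RHS]e1 /a /b; ring.
have f2 : 2 * Im v * (c * s) - Re v * (c ^+ 2 - s ^+ 2) = 0.
  by apply: (mulfI pi0); rewrite mulr0 -[RHS]e2 /a /b; ring.
set r := sqrtc _; set w := c +i* s.
have rw2 : (r * w) ^+ 2 = 1.
  rewrite exprMn sqr_sqrtc; apply: complex_eq; rewrite !expr2 !(Re_mul, Im_mul, Re_opp, Im_opp)/=.
    by rewrite -[RHS]f1; ring.
  by rewrite -[RHS]f2; ring.
have r0 : 0 < Re r by apply: sqrtc_Re_gt0; rewrite Re_mul Re_opp Im_opp/= oppr0 mul0r sub0r mulN1r opprK.
move/eqP: rw2; rewrite sqrf_eq1 => /orP[/eqP//|/eqP rw].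
have := congr1 Re rw; have := congr1 Im rw; rewrite Re_mul Im_mul /= => h1 h2.
exfalso; rewrite oppr0 in h1.
have h : Re r * (c ^+ 2 + s ^+ 2) = - c.
  transitivity (c * (Re r * c - Im r * s) + s * (Re r * s + Im r * c)); first by ring.
  by rewrite h1 h2; ring.
have : 0 <= Re r * (c ^+ 2 + s ^+ 2) by rewrite mulr_ge0 ?addr_ge0 ?sqr_ge0// ltW.
by rewrite h oppr_ge0 leNgt c0.
Qed.

Lemma integral_orbit_complex (k eta v : R[i]) (x y : R) (f : R -> R[i]) :
  let z t := (x * expR (t / 2)) +i* (y * expR (- t / 2)) in
  0 < Im v -> x != 0 -> y != 0 ->
  (forall t, f t = k * ((sprod (z t) eta)%:C *
    cexp (pi%:C * 'i%C * v * `|z t| ^+ 2))) ->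
  mu.-integrable setT (EFin \o (fun t => Re (f t))) ->
  mu.-integrable setT (EFin \o (fun t => Im (f t))) ->
  sqrtc (- 'i%C * v) * ((\int[mu]_t Re (f t)) +i* (\int[mu]_t Im (f t))) =
  k * ((Re eta * Num.sg y + Im eta * Num.sg x)%:C *
    cexp (2 * pi%:C * 'i%C * v * `|x * y|%:C)).
Proof.
move=> z v0 x0 y0 fE ire iim.
set a := pi * Im v; set b := pi * Re v.
have a0 : 0 < a by rewrite mulr_gt0 ?pi_gt0.
pose s : R := Num.sg (x * y).
have sg2 (u : R) : u != 0 -> Num.sg u * Num.sg u = 1.
  by move=> u0; rewrite -expr2 sqr_sg u0.
have s2 : s * s = 1 by apply: sg2; rewrite mulf_neq0.
have sxy : 0 < x * (s * y).
  by rewrite mulrCA -normrEsg normr_gt0 mulf_neq0.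
have sN : s * (x * y) = `|x * y| by rewrite -normrEsg.
have two : (2 : R)%:C = 2 by rewrite (rmorph_nat (real_complex R)).
pose p t := x * expR (t * 2^-1) + s * y * expR (- (t * 2^-1)).
pose q t := x * expR (t * 2^-1) - s * y * expR (- (t * 2^-1)).
have ee (t : R) : expR (t * 2^-1) * expR (- (t * 2^-1)) = 1 by rewrite expRN divff// gt_eqF ?expR_gt0.
(* The term of the scalar product along [p] is paired with the Gaussian in [q], and conversely,
   since each of [p / 2] and [q / 2] is the derivative of the other function. [A] survives the
   integration and [B] drops out. *)
pose A : R[i] := k * (Im eta + s * Re eta)%:C * cexp (2 * pi%:C * 'i%C * v * `|x * y|%:C).
pose B : R[i] := k * (Im eta - s * Re eta)%:C * cexp (- (2 * pi%:C * 'i%C * v * `|x * y|%:C)).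
have znorm t : `|z t| ^+ 2 = ((x * expR (t * 2^-1)) ^+ 2 + (y * expR (- (t * 2^-1))) ^+ 2)%:C.
  by rewrite -add_Re2_Im2 /= mulNr.
have cq t : cexp (pi%:C * 'i%C * v * `|z t| ^+ 2) =
    cexp (2 * pi%:C * 'i%C * v * `|x * y|%:C) * cgauss v (q t).
  rewrite /cgauss -cexpD; congr cexp; rewrite znorm -sN; move: pi%:C => P.
  have -> : (x * expR (t * 2^-1)) ^+ 2 + (y * expR (- (t * 2^-1))) ^+ 2 =
     2 * (s * (x * y)) + q t ^+ 2.
    rewrite /q; transitivity ((x * expR (t * 2^-1)) ^+ 2 + (s * s) * (y * expR (- (t * 2^-1))) ^+ 2
      + 2 * (s * (x * y)) * (1 - expR (t * 2^-1) * expR (- (t * 2^-1)))); last by ring.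
    by rewrite ee s2; ring.
  by rewrite rmorphD rmorphM/= two; ring.
have cp t : cexp (pi%:C * 'i%C * v * `|z t| ^+ 2) =
    cexp (- (2 * pi%:C * 'i%C * v * `|x * y|%:C)) * cgauss v (p t).
  rewrite /cgauss -cexpD; congr cexp; rewrite znorm -sN; move: pi%:C => P.
  have -> : (x * expR (t * 2^-1)) ^+ 2 + (y * expR (- (t * 2^-1))) ^+ 2 =
     p t ^+ 2 - 2 * (s * (x * y)).
    rewrite /p; transitivity ((x * expR (t * 2^-1)) ^+ 2 + (s * s) * (y * expR (- (t * 2^-1))) ^+ 2
      - 2 * (s * (x * y)) * (1 - expR (t * 2^-1) * expR (- (t * 2^-1)))); last by ring.
    by rewrite ee s2; ring.
  by rewrite rmorphB/= [(2 * _)%:C]rmorphM/= two; ring.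
have fE' t : f t = A * (p t / 2)%:C * cgauss v (q t) + B * (q t / 2)%:C * cgauss v (p t).
  rewrite fE.
  have -> : (sprod (z t) eta)%:C =
      (Im eta + s * Re eta)%:C * (p t / 2)%:C + (Im eta - s * Re eta)%:C * (q t / 2)%:C.
    rewrite -!rmorphM -rmorphD/=; congr (_%:C); rewrite /sprod Im_mul /= mulNr.
    rewrite /p /q; transitivity (x * expR (t / 2) * Im eta + (s * s) * (y * expR (- (t / 2))) * Re eta).
      by rewrite s2 mul1r.
    by field.
  (* The two occurrences of the same exponential are expanded differently, the first through [q] and
     the second through [p]. *)
  rewrite mulrDl {1}cq cp /A /B; ring.
have cc := @continuous_gauss_cos R a b; have cs := @continuous_gauss_sin R a b.
have ic := integrable_gauss_cos a0 b; have isn := integrable_gauss_sin a0 b.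
(* The real and imaginary parts of [A] times the Gaussian are [g (Re A) (- Im A)] and
   [g (Im A) (Re A)], to which the real [integral_orbit] applies. *)
pose g (c d : R) (u : R) := c * gauss_cos a b u + d * gauss_sin a b u.
have cg c d : continuous (g c d).
  move=> u; apply: cvgD.
    by apply: cvgM; [exact: cvg_cst|exact: cc].
  by apply: cvgM; [exact: cvg_cst|exact: cs].
have jc c : mu.-integrable setT (EFin \o (fun u => c * gauss_cos a b u)).
  by under [_ \o _]eq_fun do rewrite /= EFinM; exact: integrableZl.
have js c : mu.-integrable setT (EFin \o (fun u => c * gauss_sin a b u)).
  by under [_ \o _]eq_fun do rewrite /= EFinM; exact: integrableZl.
have ig c d : mu.-integrable setT (EFin \o g c d).
  exact: (integrableD measurableT (jc c) (js d)).
have intg c d : \int[mu]_u g c d u =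
    c * (\int[mu]_u gauss_cos a b u) + d * (\int[mu]_u gauss_sin a b u).
  by rewrite RintegralD// !RintegralZl.
have ReE (z1 z2 : R[i]) (r1 r2 c1 d1 c2 d2 : R) :
    Re (z1 * r1%:C * (c1 +i* d1) + z2 * r2%:C * (c2 +i* d2)) =
    r1 * (Re z1 * c1 + - Im z1 * d1) + r2 * (Re z2 * c2 + - Im z2 * d2).
  by rewrite Re_add !(Re_mul, Im_mul)/=; ring.
have ImE (z1 z2 : R[i]) (r1 r2 c1 d1 c2 d2 : R) :
    Im (z1 * r1%:C * (c1 +i* d1) + z2 * r2%:C * (c2 +i* d2)) =
    r1 * (Im z1 * c1 + Re z1 * d1) + r2 * (Im z2 * c2 + Re z2 * d2).
  by rewrite Im_add !(Re_mul, Im_mul)/=; ring.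
have iRe : \int[mu]_t Re (f t) = Num.sg x * \int[mu]_u g (Re A) (- Im A) u.
  apply: (integral_orbit sxy (cg _ _) (ig _ _) (cg (Re B) (- Im B)) (ig _ _)) => // t.
  by rewrite fE' !cgaussE ReE.
have iIm : \int[mu]_t Im (f t) = Num.sg x * \int[mu]_u g (Im A) (Re A) u.
  apply: (integral_orbit sxy (cg _ _) (ig _ _) (cg (Im B) (Re B)) (ig _ _)) => // t.
  by rewrite fE' !cgaussE ImE.
rewrite iRe iIm !intg.
have := sqrtc_gauss v0; rewrite -/a -/b.
move: (\int[mu]_q gauss_cos a b q) (\int[mu]_q gauss_sin a b q) => c d sq.
have -> : (Num.sg x * (Re A * c + - Im A * d)) +i* (Num.sg x * (Im A * c + Re A * d)) =
    (Num.sg x)%:C * A * (c +i* d).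
  by move: (A) => A'; apply: complex_eq; rewrite !(Re_mul, Im_mul)/=; ring.
rewrite mulrCA sq mulr1 /A -!mulrA mulrCA; congr (_ * _).
rewrite [LHS]mulrA -(rmorphM (real_complex R))/=; congr (_%:C * _).
have sgx := sg2 _ x0.
transitivity (Re eta * (Num.sg x * Num.sg x) * Num.sg y + Im eta * Num.sg x).
  by rewrite /s sgrM; ring.
by rewrite sgx mulr1.
Qed.

End ComplexOrbit.

(** * Quadratic fields and lattice sums *)

Section QuadraticField.
Variables (K : splittingFieldType rat) (hK : \dim {:K} = 2%N).
Variables (sigma : gal_of {:K}).
Hypotheses (hsigma : sigma \in 'Gal({:K} / 1)%g) (hsigma1 : sigma != 1%g).

Lemma galois_rat : galois 1%VS {:K}%VS.
Proof.
rewrite /galois sub1v normalFieldf andbT /=.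
by apply/separableP => u _; apply: pcharf0_separable; 
  by move=> p; rewrite pchar_lalg pchar_num.
Qed.

Lemma Gal_quadratic : 'Gal({:K} / 1)%g = [set 1%g; sigma]%SET.
Proof.
apply/eqP; rewrite eq_sym eqEcard finset.subUset !finset.sub1set group1 hsigma/=.
rewrite -(galois_dim galois_rat) hK dimv1 divn1 cards2 eq_sym hsigma1//.
Qed.

Lemma fixed_rational (x : K) : sigma x = x -> exists r : rat, x = r%:A.
Proof.
move=> sx; apply/vlineP; have /galois_fixedField <- := galois_rat.
apply/fixedFieldP; first exact: memvf.
by move=> y; rewrite Gal_quadratic !inE => /orP[] /eqP -> //; rewrite gal_id.
Qed.

Lemma sigma_involutive (x : K) : sigma (sigma x) = x.
Proof.
have : (sigma * sigma)%g \in 'Gal({:K} / 1)%g by rewrite groupM.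
rewrite Gal_quadratic !inE => /orP[/eqP s1|/eqP].
  by rewrite -galM ?memvf// s1 gal_id.
by rewrite -[X in _ = X]mulg1 => /mulgI s1; move: hsigma1; rewrite s1 eqxx.
Qed.

Lemma trQE (x : K) : trQ x = x + sigma x.
Proof.
rewrite /trQ /galTrace Gal_quadratic big_setU1/= ?big_set1 ?gal_id//.
by rewrite inE eq_sym.
Qed.

(** The monic equation is transported to the algebraic numbers, where a rational algebraic integer
    is an integer. *)
Lemma integral_rat_int (r : rat) : integralOver (intr : int -> K) (r%:A) ->
  exists n : int, r = n%:~R.
Proof.
case=> p pm pr.
have h : ratr r \in Aint.
  apply: (@root_monic_Aint (map_poly (intr : int -> algC) p)).
  - move: pr; rewrite /root => /eqP pr.
    have E1 : map_poly (intr : int -> K) p = map_poly (in_alg K) (map_poly (intr : int -> rat) p).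
      by rewrite -map_poly_comp; apply: eq_map_poly => n; rewrite [RHS](rmorph_int (in_alg K)).
    have E2 : map_poly (intr : int -> algC) p = map_poly (ratr : rat -> algC) (map_poly (intr : int -> rat) p).
      by rewrite -map_poly_comp; apply: eq_map_poly => n /=; rewrite rmorph_int.
    have : in_alg K (map_poly (intr : int -> rat) p).[r] = 0 by rewrite -horner_map -E1.
    by rewrite E2 horner_map => /eqP; rewrite fmorph_eq0 => /eqP ->; rewrite rmorph0.
  - exact: monic_map.
  - by apply/polyOverP => i; rewrite coef_map /= intr_int.
have /(Cint_rat_Aint (Crat_rat _)) := h.
by move=> /intrP[n /esym]; rewrite -(ratr_int algC) => /fmorph_inj <-; exists n.
Qed.

(** The norms of u and of its inverse are rational algebraic integers with product 1, and total
    positivity excludes -1. *)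
Lemma norm_unit_eq1 (R : realType) (iota : {rmorphism K -> R}) (u : K) :
  field_unit u -> totally_positive iota sigma u -> u * sigma u = 1.
Proof.
move=> [u0 iu iuV] [pu psu].
have int_norm (w : K) : integralOver (intr : int -> K) w -> exists n : int, w * sigma w = n%:~R.
  move=> iw; have [|r rE] := @fixed_rational (w * sigma w).
    by rewrite rmorphM/= sigma_involutive mulrC.
  have [|n nE] := @integral_rat_int r.
    rewrite -rE; apply: integral_mul => //.
    case: iw => p pm pr; exists p => //.
    have -> : map_poly (intr : int -> K) p = map_poly sigma (map_poly (intr : int -> K) p).
      by rewrite -map_poly_comp; apply: eq_map_poly => n /=; rewrite rmorph_int.
    by rewrite fmorph_root.
  by exists n; rewrite rE nE scaler_int.
have [m mE] := int_norm u iu; have [n nE] := int_norm _ iuV.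
have m0 : (0 : R) < m%:~R by rewrite -(rmorph_int iota) -mE rmorphM mulr_gt0.
have mn : (m * n)%:~R = 1 :> R.
  rewrite -(rmorph_int iota) intrM -mE -nE rmorphV ?unitfE//=.
  by rewrite mulrACA divff// divff ?mulr1 ?rmorph1// fmorph_eq0.
have {}mn : m * n = 1 by apply/eqP; rewrite -(eqr_int R) mn.
rewrite ltr0z in m0; have n1 : `|m|%N = 1%N.
  by apply/eqP; move/(congr1 absz)/eqP: mn; rewrite abszM muln_eq1 => /andP[].
by rewrite mE -[m](gez0_abs (ltW m0)) n1.
Qed.

End QuadraticField.

Section LatticeSum.
Context {R : realType}.

Lemma esum_geometric_lty (r : R) : 0 < r < 1 ->
  (\esum_(n in [set: nat]) (r ^+ n)%:E < +oo)%E.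
Proof.
move=> /andP[r0 r1]; have ge0 n : (0 <= (r ^+ n)%:E)%E by rewrite lee_fin exprn_ge0// ltW.
rewrite -nneseries_esumT//; apply: (@le_lt_trans _ _ ((1 - r)^-1)%:E); last exact: ltry.
apply: lime_le; first exact: is_cvg_nneseries.
apply: nearW => n; rewrite sumEFin lee_fin.
have -> : \sum_(0 <= i < n) r ^+ i = series (geometric 1 r) n.
  by apply: eq_bigr => i _; rewrite /= mul1r.
rewrite geometric_seriesE ?lt_eqF//= mul1r ler_pdivrMr ?subr_gt0//.
by rewrite mulVf ?gerBl ?exprn_ge0 ?ltW// subr_eq0 gt_eqF.
Qed.

Lemma esum_int_lty (r : R) : 0 < r < 1 ->
  (\esum_(m in [set: int]) (r ^+ absz m)%:E < +oo)%E.
Proof.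
move=> r01; have /andP[r0 r1] := r01.
have ge0 n : (0 <= (r ^+ n)%:E)%E by rewrite lee_fin exprn_ge0// ltW.
rewrite (esumID (range Posz))// setTI setTI; apply: lte_add_pinfty.
  by rewrite esum_image ?esum_geometric_lty// => m n _ _ [].
rewrite (_ : ~` range Posz = range Negz); last first.
  apply/seteqP; split => [[n|n] h|_ [n _ <-] [m _]//]; last by exists n.
  by exfalso; apply: h; exists n.
rewrite esum_image; last by move=> m n _ _ [].
apply: le_lt_trans (esum_geometric_lty r01); apply: le_esum => n _.
(* [Negz n] has absolute value n + 1, which gives one more factor r < 1. *)
by rewrite lee_fin /= exprS ler_piMl ?exprn_ge0 ?ltW.
Qed.

(** One inequality holds for every nonnegative factor; for c > 0 the other is the same one for the
    factor [c^-1]. *)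
Lemma esumZl (T : choiceType) (X : set T) (c : R) (f : T -> R) : 0 <= c ->
  (forall x, 0 <= f x) ->
  (\esum_(x in X) (c * f x)%:E = c%:E * \esum_(x in X) (f x)%:E)%E.
Proof.
have le_esumZ (k : R) (g : T -> R) : 0 <= k -> (forall x, 0 <= g x) ->
    (\esum_(x in X) (k * g x)%:E <= k%:E * \esum_(x in X) (g x)%:E)%E.
  move=> k0 g0; apply: ge_ereal_sup => _ [F [finF FX] <-].
  rewrite [leLHS](_ : _ = k%:E * \sum_(x \in F) (g x)%:E)%E; last first.
    by rewrite ge0_mule_fsumr// => x; rewrite lee_fin.
  rewrite lee_wpmul2l ?lee_fin//; apply: esum_ge; exists F => //.
move=> c0 f0; apply/eqP; rewrite eq_le le_esumZ//=.
have [->|cn0] := eqVneq c 0.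
  by rewrite mul0e esum_ge0// => x Xx; rewrite lee_fin mul0r.
have {cn0}c0 : 0 < c by rewrite lt_neqAle eq_sym cn0.
rewrite -lee_pdivlMl//; apply: le_trans (le_esumZ c^-1 (fun x => c * f x) _ _).
- by apply: le_esum => x Xx; rewrite lee_fin mulKf// gt_eqF.
- by rewrite invr_ge0 ltW.
- by move=> x; rewrite mulr_ge0 ?f0// ltW.
Qed.

Lemma esum_int2_lty (r : R) : 0 < r < 1 ->
  (\esum_(z in [set: int * int]) (r ^+ absz z.1 * r ^+ absz z.2)%:E < +oo)%E.
Proof.
move=> r01; have /andP[r0 r1] := r01; have S := esum_int_lty r01.
have ge0 n : (0 <= r ^+ n) by rewrite exprn_ge0// ltW.
pose a (m n : int) := (r ^+ absz m * r ^+ absz n)%:E.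
rewrite (_ : esum _ _ = \esum_(z in [set: int] `*`` (fun=> [set: int])) a z.1 z.2)%E; last first.
  by rewrite (_ : _ `*`` _ = setT)//; apply/seteqP; split.
rewrite -esum_esum; last by move=> m n _ _; rewrite /a lee_fin mulr_ge0.
pose s := fine (\esum_(m in [set: int]) (r ^+ absz m)%:E)%E.
have sE : (\esum_(m in [set: int]) (r ^+ absz m)%:E)%E = s%:E.
  by rewrite fineK// ge0_fin_numE// esum_ge0// => m _; rewrite lee_fin.
have s0 : 0 <= s by rewrite fine_ge0// esum_ge0// => m _; rewrite lee_fin.
rewrite (eq_esum (b := fun m : int => (s * r ^+ absz m)%:E)).
  by rewrite esumZl// sE -EFinM ltry.
by move=> m _; rewrite /a esumZl// sE mulrC -EFinM.
Qed.

(** Cramer's rule bounds the integer coordinates linearly by u = |x1| + |x2|, so the Gaussian decay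
    in u dominates a product of two geometric series. *)
Lemma gauss_lattice_lty (a1 b1 a2 b2 l1 l2 c : R) (x1 x2 : int * int -> R) :
  (forall z, x1 z = l1 + (z.1%:~R * a1 + z.2%:~R * b1)) ->
  (forall z, x2 z = l2 + (z.1%:~R * a2 + z.2%:~R * b2)) ->
  a1 * b2 - b1 * a2 != 0 ->
  0 < c ->
  (\esum_(z in [set: int * int])
    ((`|x1 z| + `|x2 z|) * expR (- c * (x1 z ^+ 2 + x2 z ^+ 2)))%:E < +oo)%E.
Proof.
move=> x1E x2E D0 c0.
set D := a1 * b2 - b1 * a2 in D0.
pose M := `|a1| + `|a2| + `|b1| + `|b2|.
(* Twice the Cramer bound, one for each coordinate; the added 1 keeps [B] positive, so that r =
   e^(-1/B) is defined and less than 1. *)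
pose B := 1 + `|D|^-1 * M * (1 + `|l1| + `|l2|) *+ 2.
have M0 : 0 <= M by rewrite !addr_ge0.
have B0 : 0 < B.
  by rewrite ltr_pwDl// mulrn_wge0// !mulr_ge0 ?invr_ge0 ?addr_ge0.
pose r := expR (- B^-1).
have r01 : 0 < r < 1 by rewrite expR_gt0 expR_lt1 oppr_lt0 invr_gt0 B0.
(* The constant comes from u e^(-c u^2 / 2) <= e^(u - c u^2 / 2) <= e^(2/c - u) = e^(1 + 2/c) e^(-(1
   + u)), where 1 + u is at least (|m| + |n|)/B for z = (m, n). *)
apply: (@le_lt_trans _ _ (\esum_(z in [set: int * int])
  (expR (1 + 2 / c) * (r ^+ absz z.1 * r ^+ absz z.2))%:E)%E); last first.
  rewrite esumZl ?expR_ge0//; last first.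
    by move=> z; rewrite mulr_ge0// exprn_ge0// ltW//; case/andP: r01.
  have S := esum_int2_lty r01.
  rewrite lte_mul_pinfty ?lee_fin ?expR_ge0//.
apply: le_esum => z _; rewrite lee_fin.
set u := `|x1 z| + `|x2 z|.
have u0 : 0 <= u by rewrite addr_ge0.
have key : (absz z.1)%:R + (absz z.2)%:R <= B * (1 + u).
  have absE (i : int) : (absz i)%:R = `|i%:~R| :> R by rewrite natr_absz intr_norm.
  have bound (w s1 s2 e1 e2 : R) : w * D = s1 * e1 - s2 * e2 ->
      `|s1| + `|s2| <= `|x1 z| + `|l1| + (`|x2 z| + `|l2|) ->
      `|e1| <= M -> `|e2| <= M -> `|w| <= `|D|^-1 * M * (1 + `|l1| + `|l2|) * (1 + u).
    move=> wD s12 e1M e2M.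
    rewrite -mulrA -mulrA ler_pdivlMl ?normr_gt0// mulrC -normrM wD.
    apply: le_trans (ler_normB _ _) _; rewrite !normrM.
    apply: (@le_trans _ _ (M * (`|s1| + `|s2|))).
      by rewrite mulrDr lerD// mulrC ler_wpM2r.
    rewrite ler_wpM2l// (le_trans s12)// /u.
    have := normr_ge0 l1; have := normr_ge0 l2; have := normr_ge0 (x1 z); have := normr_ge0 (x2 z).
    by move: `|x1 z| `|x2 z| `|l1| `|l2| => A A' E E'; nra.
  have e (w : R) : `|w| \in [:: `|a1|; `|a2|; `|b1|; `|b2|] -> `|w| <= M.
    have := normr_ge0 a1; have := normr_ge0 a2; have := normr_ge0 b1; have := normr_ge0 b2.
    by rewrite !inE /M => ? ? ? ? /or4P[] /eqP ->; lra.
  rewrite !absE; apply: (@le_trans _ _ (`|D|^-1 * M * (1 + `|l1| + `|l2|) *+ 2 * (1 + u))).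
    rewrite mulrnAl mulr2n; apply: lerD.
      apply: (bound _ (x1 z - l1) (x2 z - l2) b2 b1).
      - by rewrite x1E x2E /D; ring.
      - by apply: lerD; exact: ler_normB.
      - by rewrite e// !inE !(eqxx, orbT).
      - by rewrite e// !inE !(eqxx, orbT).
    apply: (bound _ (x2 z - l2) (x1 z - l1) a1 a2).
    - by rewrite x1E x2E /D; ring.
    - by rewrite addrC; apply: lerD; exact: ler_normB.
    - by rewrite e// !inE !(eqxx, orbT).
    - by rewrite e// !inE !(eqxx, orbT).
  by rewrite ler_wpM2r ?addr_ge0// lerDr.
have q : u ^+ 2 / 2 <= x1 z ^+ 2 + x2 z ^+ 2.
  rewrite -(real_normK (num_real (x1 z))) -(real_normK (num_real (x2 z))) /u.
  have := sqr_ge0 (`|x1 z| - `|x2 z|); move: `|x1 z| `|x2 z| => A A'.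
  by rewrite !expr2; lra.
rewrite /r -!expRM_natl -!expRD.
apply: (@le_trans _ _ (expR u * expR (- c * (x1 z ^+ 2 + x2 z ^+ 2)))).
  by rewrite ler_wpM2r ?expR_ge0// (le_trans _ (expR_ge1Dx _))// lerDr.
rewrite -expRD ler_expR.
have h1 : ((absz z.1)%:R + (absz z.2)%:R) / B <= 1 + u by rewrite ler_pdivrMr// mulrC.
(* Completing the square turns the Gaussian decay into [expR (- (1 + u))]. *)
have h2 : 2 * u <= 2 / c + c * (u ^+ 2 / 2).
  rewrite -subr_ge0 (_ : _ - _ = (c * u - 2) ^+ 2 / (2 * c)); last by field; rewrite gt_eqF.
  by rewrite divr_ge0 ?sqr_ge0// mulr_ge0// ltW.
have h3 : c * (u ^+ 2 / 2) <= c * (x1 z ^+ 2 + x2 z ^+ 2) by rewrite ler_wpM2l// ltW.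
move: h1 h2 h3; rewrite mulrDl mulNr !mulrN; lra.
Qed.

End LatticeSum.

(** * Unfolding the theta series *)

Section SignedSums.
Context {R : realType} {T : choiceType}.
Implicit Types (D : set T) (f g : T -> R).

Lemma eq_rsum D f g : (forall x, D x -> f x = g x) -> rsum D f = rsum D g.
Proof.
move=> fg; rewrite /rsum; congr (fine _ - fine _); apply: eq_esum => x Dx.
  by rewrite /funrpos fg.
by rewrite /funrneg fg.
Qed.

Lemma esum_support D (B : set T) (a : T -> \bar R) : (forall x, D x -> 0 <= a x)%E ->
  (forall x, D x -> ~ B x -> a x = 0%E) ->
  (\esum_(x in D) a x = \esum_(x in D `&` B) a x)%E.
Proof.
move=> a0 aB; rewrite (esumID B)// [X in (_ + X)%E]esum1 ?adde0// => x [Dx nB].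
exact: aB.
Qed.

Lemma rsum_support D (B : set T) f : (forall x, D x -> ~ B x -> f x = 0) ->
  rsum D f = rsum (D `&` B) f.
Proof.
move=> fB; rewrite /rsum; congr (fine _ - fine _); apply: esum_support => x Dx.
- by rewrite lee_fin funrpos_ge0.
- by move=> nB; rewrite /funrpos fB// maxxx.
- by rewrite lee_fin funrneg_ge0.
- by move=> nB; rewrite /funrneg fB// oppr0 maxxx.
Qed.

Lemma rsum_reindex (T' : choiceType) (D' : set T') (D : set T) (e : T' -> T) f :
  set_bij D' D e -> rsum D f = rsum D' (f \o e).
Proof. by move=> De; rewrite /rsum !(reindex_esum _ _ _ _ De). Qed.

Definition rsummable D f := (\esum_(x in D) `|f x|%:E < +oo)%E.

Lemma rsummable_parts D f : rsummable D f ->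
  (\esum_(x in D) (f^\+ x)%:E < +oo)%E /\ (\esum_(x in D) (f^\- x)%:E < +oo)%E.
Proof.
move=> sf; split; apply: le_lt_trans sf; apply: le_esum => x _; rewrite lee_fin.
  by rewrite /funrpos ge_max ler_norm normr_ge0.
by rewrite /funrneg ge_max -normrN ler_norm normr_ge0.
Qed.

Lemma fin_esum D f : (forall x, 0 <= f x) -> (\esum_(x in D) (f x)%:E < +oo)%E ->
  (\esum_(x in D) (f x)%:E)%E \is a fin_num.
Proof.
by move=> f0 ff; rewrite ge0_fin_numE// esum_ge0// => x _; rewrite lee_fin.
Qed.

Lemma funr_posneg f x : f x = f^\+ x - f^\- x.
Proof. by rewrite /funrpos /funrneg; case: (leP (f x) 0); case: (leP (- f x) 0); lra. Qed.

(** Positive parts are not additive, so the sum is split as (f^+ + g^+) - (f^- + g^-), which [rsumE]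
    accepts. *)
Lemma rsumD D f g : rsummable D f -> rsummable D g ->
  rsum D (fun x => f x + g x) = rsum D f + rsum D g.
Proof.
move=> /rsummable_parts[fp fn] /rsummable_parts[gp gn].
rewrite (@eq_rsum _ _ (fun x => (f^\+ x + g^\+ x) - (f^\- x + g^\- x))); last first.
  by move=> x _; rewrite {1}(funr_posneg f) {1}(funr_posneg g); ring.
have p0 h x : 0 <= h^\+ x :> R by exact: funrpos_ge0.
have n0 h x : 0 <= h^\- x :> R by exact: funrneg_ge0.
have dE (u w : T -> R) : (forall x, 0 <= u x) -> (forall x, 0 <= w x) ->
    (\esum_(x in D) (u x + w x)%:E = \esum_(x in D) (u x)%:E + \esum_(x in D) (w x)%:E)%E.
  by move=> u0 w0; rewrite -esumD// => x _; rewrite lee_fin.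
rewrite rsumE ?dE//; try by move=> *; rewrite addr_ge0.
- rewrite !fineD ?fin_esum// /rsum; ring.
- exact: lte_add_pinfty.
- exact: lte_add_pinfty.
Qed.

Lemma rsumZ D c f : rsummable D f -> rsum D (fun x => c * f x) = c * rsum D f.
Proof.
move=> /rsummable_parts[fp fn].
have p0 x : 0 <= f^\+ x by exact: funrpos_ge0.
have n0 x : 0 <= f^\- x by exact: funrneg_ge0.
have pfin := fin_esum p0 fp; have nfin := fin_esum n0 fn.
have [c0|c0] := leP 0 c.
  rewrite (@eq_rsum _ _ (fun x => c * f^\+ x - c * f^\- x)); last first.
    by move=> x _; rewrite {1}(funr_posneg f); ring.
  rewrite rsumE ?esumZl//; try by move=> *; rewrite mulr_ge0.
  - by rewrite !fineM// /rsum mulrBr.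
  - by rewrite -(fineK pfin) -EFinM ltry.
  - by rewrite -(fineK nfin) -EFinM ltry.
(* A negative factor exchanges the two parts. *)
rewrite (@eq_rsum _ _ (fun x => (- c) * f^\- x - (- c) * f^\+ x)); last first.
  by move=> x _; rewrite {1}(funr_posneg f); ring.
have nc0 : 0 <= - c by rewrite oppr_ge0 ltW.
rewrite rsumE ?esumZl//; try by move=> *; rewrite mulr_ge0.
- by rewrite !fineM// /rsum -[fine (- c)%:E]/(- c); ring.
- by rewrite -(fineK nfin) -EFinM ltry.
- by rewrite -(fineK pfin) -EFinM ltry.
Qed.

Lemma rsummableZ D c f : rsummable D f -> rsummable D (fun x => c * f x).
Proof.
move=> sf; rewrite /rsummable.
under eq_esum do rewrite normrM.
by rewrite esumZl// -(fineK (fin_esum (fun x => normr_ge0 (f x)) sf)) -EFinM ltry.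
Qed.

Lemma csumZ D (c : R[i]) (h : T -> R[i]) :
  rsummable D (fun x => complex.Re (h x)) -> rsummable D (fun x => complex.Im (h x)) ->
  csum D (fun x => c * h x) = c * csum D h.
Proof.
move=> sr si; apply: complex_eq.
  rewrite Re_mul /csum/= -mulNr -(rsumZ (complex.Re c) sr) -(rsumZ (- complex.Im c) si).
  rewrite -(rsumD (rsummableZ _ sr) (rsummableZ _ si)).
  by apply: eq_rsum => x _; rewrite Re_mul mulNr.
rewrite Im_mul /csum/= -(rsumZ (complex.Re c) si) -(rsumZ (complex.Im c) sr).
rewrite -(rsumD (rsummableZ _ si) (rsummableZ _ sr)).
by apply: eq_rsum => x _; rewrite Im_mul.
Qed.

End SignedSums.

Section ComplexNorm.
Context {R : realType}.
Local Notation normc := (@ComplexField.Normc.normc R).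
Implicit Types z w : R[i].

Lemma normc_cexp z : normc (cexp z) = expR (complex.Re z).
Proof.
rewrite cexpE /= !exprMn -mulrDr cos2Dsin2 mulr1 sqrtr_sqr ger0_norm//.
Qed.

Lemma normc_real (x : R) : normc x%:C = `|x|.
Proof. by rewrite /= expr0n addr0 sqrtr_sqr. Qed.

Lemma normc_ge_absRe z : `|complex.Re z| <= normc z.
Proof.
case: z => x y /=; rewrite -sqrtr_sqr ler_wsqrtr// lerDl sqr_ge0//.
Qed.

Lemma normc_ge_absIm z : `|complex.Im z| <= normc z.
Proof.
case: z => x y /=; rewrite -sqrtr_sqr ler_wsqrtr// lerDr sqr_ge0//.
Qed.

Lemma normc_ge0 z : 0 <= normc z.
Proof. exact: le_trans (normr_ge0 _) (normc_ge_absRe z). Qed.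

Lemma normc_le_abs z : normc z <= `|complex.Re z| + `|complex.Im z|.
Proof.
case: z => x y /=; rewrite -[leRHS]ger0_norm ?addr_ge0// -sqrtr_sqr ler_wsqrtr//.
rewrite sqrrD !real_normK ?num_real// addrAC lerDl mulrn_wge0// mulr_ge0//.
Qed.

End ComplexNorm.

(** * The summand as a function of t *)

Section OrbitFunction.
Variables (R : realType) (K : splittingFieldType rat).
Variables (iota : {rmorphism K -> R}) (sigma : gal_of {:K}).
Variables (l0 m0 : K) (eta v : R[i]).
Local Notation normc := (@ComplexField.Normc.normc R).
Local Notation mu := (@lebesgue_measure R).

(** The exponential factor shared by the two theta series. It is independent of t, because e^(t/2)
    and e^(-t/2) cancel in the scalar product of the points of two field elements. *)
Definition character_at (x : K) : R[i] :=
  cexp (- (2 * pi%:C * 'i%C * (iota (trQ (sigma (x - l0) * m0)))%:C)) *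
  cexp (- (pi%:C * 'i%C * (iota (trQ (sigma l0 * m0)))%:C)).

(** The f_x(t) of the overview. *)
Definition orbit_fun (x : K) (t : R) : R[i] :=
  character_at x * ((sprod (cplx_point iota sigma t x) eta)%:C *
    cexp (pi%:C * 'i%C * v * `|cplx_point iota sigma t x| ^+ 2)).

Lemma cplx_pointD t x y :
  cplx_point iota sigma t (x + y) = cplx_point iota sigma t x + cplx_point iota sigma t y.
Proof. by apply: complex_eq; rewrite /cplx_point /= !rmorphD mulrDl. Qed.

Lemma cplx_point_inj t : injective (cplx_point iota sigma t).
Proof.
move=> x y [/mulIf h _]; apply: (fmorph_inj iota); apply: h.
by rewrite gt_eqF ?expR_gt0.
Qed.

Lemma sqr_norm_cplx_point t x : `|cplx_point iota sigma t x| ^+ 2 =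
  (iota x ^+ 2 * expR t + iota (sigma x) ^+ 2 * expR (- t))%:C.
Proof.
rewrite -add_Re2_Im2 /cplx_point /= !exprMn -!expRM_natl.
by congr ((_ * expR _ + _ * expR _)%:C); field.
Qed.

Lemma sprod_cplx_point t x : sprod (cplx_point iota sigma t x) eta =
  iota x * expR (t / 2) * complex.Im eta + iota (sigma x) * expR (- t / 2) * complex.Re eta.
Proof. by rewrite /sprod Im_mul. Qed.

Lemma normc_character x : normc (character_at x) = 1.
Proof.
have unit (y : R) : normc (cexp (- (pi%:C * 'i%C * y%:C))) = 1.
  rewrite normc_cexp Re_opp !(Re_mul, Im_mul)/=.
  by rewrite (_ : - _ = 0) ?expR0//; ring.
have two : (2 : R)%:C = 2 by rewrite (rmorph_nat (real_complex R)).
rewrite /character_at ComplexField.Normc.normcM unit mulr1 -two.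
have -> : 2%:C * pi%:C * 'i%C * (iota (trQ (sigma (x - l0) * m0)))%:C =
    pi%:C * 'i%C * (2 * iota (trQ (sigma (x - l0) * m0)))%:C.
  by rewrite [(2 * _)%:C](rmorphM (real_complex R))/=; ring.
exact: unit.
Qed.

Lemma cexp_sqr_norm t x : cexp (pi%:C * 'i%C * v * `|cplx_point iota sigma t x| ^+ 2) =
  let q := iota x ^+ 2 * expR t + iota (sigma x) ^+ 2 * expR (- t) in
  (expR (- (pi * complex.Im v) * q) * cos (pi * complex.Re v * q)) +i*
  (expR (- (pi * complex.Im v) * q) * sin (pi * complex.Re v * q)).
Proof.
rewrite sqr_norm_cplx_point cexpE !(Re_mul, Im_mul)/=.
by congr ((expR _ * cos _) +i* (expR _ * sin _)); ring.
Qed.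

Lemma normc_orbit_fun x t : normc (orbit_fun x t) =
  `|sprod (cplx_point iota sigma t x) eta| *
  expR (- (pi * complex.Im v) * (iota x ^+ 2 * expR t + iota (sigma x) ^+ 2 * expR (- t))).
Proof.
rewrite /orbit_fun ComplexField.Normc.normcM normc_character mul1r.
rewrite ComplexField.Normc.normcM normc_real.
congr (_ * _); rewrite normc_cexp sqr_norm_cplx_point !(Re_mul, Im_mul)/=.
by congr expR; ring.
Qed.

(** On [-A, A] the linear factor grows at most by e^(A/2), and in the Gaussian both e^t and e^(-t)
    are at least e^(-A). *)
Lemma orbit_fun_le x t A : 0 < complex.Im v -> `|t| <= A ->
  normc (orbit_fun x t) <=
  (`|complex.Re eta| + `|complex.Im eta|) * expR (A / 2) *
  ((`|iota x| + `|iota (sigma x)|) *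
   expR (- (pi * complex.Im v * expR (- A)) * (iota x ^+ 2 + iota (sigma x) ^+ 2))).
Proof.
move=> v0 tA; rewrite normc_orbit_fun.
have := tA; rewrite ler_norml => /andP[tA1 tA2].
have e0 := expR_ge0 (A / 2).
have e1 : expR (t / 2) <= expR (A / 2) by rewrite ler_expR ler_pM2r.
have e2 : expR (- t / 2) <= expR (A / 2) by rewrite ler_expR ler_pM2r//; lra.
rewrite mulrA; apply: ler_pM; rewrite ?expR_ge0//.
  rewrite sprod_cplx_point; apply: le_trans (ler_normD _ _) _.
  rewrite !normrM !(ger0_norm (expR_ge0 _)).
  have a1 : `|iota x| * expR (t / 2) * `|complex.Im eta| <=
      `|iota x| * expR (A / 2) * (`|complex.Re eta| + `|complex.Im eta|).
    by apply: ler_pM; rewrite ?mulr_ge0 ?expR_ge0// ?ler_wpM2l// lerDr.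
  have a2 : `|iota (sigma x)| * expR (- t / 2) * `|complex.Re eta| <=
      `|iota (sigma x)| * expR (A / 2) * (`|complex.Re eta| + `|complex.Im eta|).
    by apply: ler_pM; rewrite ?mulr_ge0 ?expR_ge0// ?ler_wpM2l// lerDl.
  apply: le_trans (lerD a1 a2) _.
  by rewrite le_eqVlt; apply/orP; left; apply/eqP; ring.
rewrite ler_expR !mulNr lerN2 -[leLHS]mulrA; apply: ler_wpM2l.
  by rewrite mulr_ge0 ?pi_ge0// ltW.
rewrite mulrDr; apply: lerD; rewrite mulrC ler_wpM2l ?sqr_ge0// ler_expR; lra.
Qed.

Lemma continuous_orbit_fun x :
  continuous (fun t => complex.Re (orbit_fun x t)) /\
  continuous (fun t => complex.Im (orbit_fun x t)).
Proof.
have dE c (t : R) := derive_expR_half c t.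
have cE (c : R) : continuous (fun t : R => expR (t * c)).
  exact: is_derive_continuous (dE c).
pose q t := iota x ^+ 2 * expR (t * 1) + iota (sigma x) ^+ 2 * expR (t * -1).
pose p t := iota x * expR (t * 2^-1) * complex.Im eta + iota (sigma x) * expR (t * - 2^-1) * complex.Re eta.
have cq : continuous q.
  by move=> t; apply: cvgD; (apply: cvgM; [exact: cvg_cst|exact: cE]).
have cp : continuous p.
  move=> t; apply: cvgD; (apply: cvgM; [apply: cvgM; [exact: cvg_cst|exact: cE]|exact: cvg_cst]).
have cqe (c : R) : continuous (fun t => expR (c * q t)).
  move=> t; apply: continuous_comp; last exact: continuous_expR.
  by apply: cvgM; [exact: cvg_cst|exact: cq].
have cqc (c : R) : continuous (fun t => cos (c * q t)).
  move=> t; apply: continuous_comp; last exact: continuous_cos.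
  by apply: cvgM; [exact: cvg_cst|exact: cq].
have cqs (c : R) : continuous (fun t => sin (c * q t)).
  move=> t; apply: continuous_comp; last exact: continuous_sin.
  by apply: cvgM; [exact: cvg_cst|exact: cq].
pose a := - (pi * complex.Im v); pose b := pi * complex.Re v.
have fE t : orbit_fun x t = character_at x * ((p t)%:C *
    ((expR (a * q t) * cos (b * q t)) +i* (expR (a * q t) * sin (b * q t)))).
  by rewrite /orbit_fun cexp_sqr_norm sprod_cplx_point /p /q mulr1 !mulrN !mulr1 mulNr.
have ch : continuous (fun t => p t * (expR (a * q t) * cos (b * q t))).
  by move=> t; apply: cvgM; [exact: cp|apply: cvgM; [exact: cqe|exact: cqc]].
have sh : continuous (fun t => p t * (expR (a * q t) * sin (b * q t))).
  by move=> t; apply: cvgM; [exact: cp|apply: cvgM; [exact: cqe|exact: cqs]].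
split.
  rewrite (_ : (fun _ => _) = fun t =>
     complex.Re (character_at x) * (p t * (expR (a * q t) * cos (b * q t))) +
     (- complex.Im (character_at x)) * (p t * (expR (a * q t) * sin (b * q t)))).
    by move=> t; apply: cvgD; (apply: cvgM; [exact: cvg_cst|]); [exact: ch|exact: sh].
  by apply/funext => t; rewrite fE; move: (character_at x) => k; rewrite !(Re_mul, Im_mul)/=; ring.
rewrite (_ : (fun _ => _) = fun t =>
   complex.Im (character_at x) * (p t * (expR (a * q t) * cos (b * q t))) +
   complex.Re (character_at x) * (p t * (expR (a * q t) * sin (b * q t)))).
  by move=> t; apply: cvgD; (apply: cvgM; [exact: cvg_cst|]); [exact: ch|exact: sh].
by apply/funext => t; rewrite fE; move: (character_at x) => k; rewrite !(Re_mul, Im_mul)/=; ring.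
Qed.

End OrbitFunction.

(** * Action of the units on the coset *)

Section Arithmetic.
Variables (R : realType) (K : splittingFieldType rat).
Hypothesis hK : \dim {:K} = 2%N.
Variables (iota : {rmorphism K -> R}) (sigma : gal_of {:K}).
Hypotheses (hsigma : sigma \in 'Gal({:K} / 1)%g) (hsigma1 : sigma != 1%g).
Variables (l0 m0 : K) (eta v : R[i]).

(** If the determinant vanished, a/b would be fixed by [sigma], hence rational, and clearing its
    denominator would give a relation between a and b. *)
Lemma det_conj_neq0 (a b : K) :
  (forall m n : int, a *~ m + b *~ n = 0 -> m = 0 /\ n = 0) ->
  iota a * iota (sigma b) - iota b * iota (sigma a) != 0.
Proof.
move=> free; rewrite -!rmorphM -rmorphB fmorph_eq0 subr_eq0; apply/eqP => ab.
have b0 : b != 0.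
  apply/eqP => b0; have [|_ /eqP] := free 0 1; last by rewrite oner_eq0.
  by rewrite mulr0z add0r b0 mul0rz.
have sb0 : sigma b != 0 by rewrite fmorph_eq0.
have [|r rE] := @fixed_rational K hK sigma hsigma hsigma1 (a / b).
  rewrite rmorphM fmorphV/=; apply: (mulIf sb0); rewrite divfK//.
  by apply: (mulIf b0); rewrite mulrAC divfK// ab mulrC.
have d0 : denq r != 0 by rewrite denq_neq0.
have [|/eqP] := free (denq r) (- numq r); last by rewrite (negbTE d0).
rewrite mulrNz -(mulrzr a) -(mulrzr b); apply/eqP; rewrite subr_eq0; apply/eqP.
have -> : a = b * r%:A by rewrite -rE mulrC divfK.
rewrite -mulrA; congr (b * _).
rewrite -(rmorph_int (in_alg K)) -(rmorph_int (in_alg K) (numq r)) -(rmorphM (in_alg K)).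
by rewrite numqE.
Qed.

Lemma theta_termE t l :
  theta_term eta (cplx_point iota sigma t l0) (cplx_point iota sigma t m0) v
    (cplx_point iota sigma t l) = orbit_fun iota sigma l0 m0 eta v (l0 + l) t.
Proof.
have sE (x : K) : sprod (cplx_point iota sigma t x) (cplx_point iota sigma t m0) =
    iota (trQ (sigma x * m0)).
  rewrite (trQE hK hsigma hsigma1) /sprod Im_mul /= rmorphD !rmorphM/=.
  rewrite (sigma_involutive hK hsigma hsigma1).
  have e : expR (t / 2) * expR (- t / 2) = 1 by rewrite mulNr expRN divff// gt_eqF ?expR_gt0.
  transitivity ((iota (sigma x) * iota m0 + iota x * iota (sigma m0)) * (expR (t / 2) * expR (- t / 2))).
    by ring.
  by rewrite e mulr1.
rewrite /theta_term /orbit_fun /character_at !sE -cplx_pointD cexpD addrAC subrr add0r.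
by rewrite [RHS]mulrC.
Qed.

Lemma Theta_termE x : x != 0 -> 0 < complex.Im v ->
  let f := orbit_fun iota sigma l0 m0 eta v x in
  lebesgue_measure.-integrable setT (EFin \o (fun t => complex.Re (f t))) ->
  lebesgue_measure.-integrable setT (EFin \o (fun t => complex.Im (f t))) ->
  Theta_term iota sigma eta l0 m0 v x = sqrtc (- 'i%C * v) *
  ((\int[lebesgue_measure]_t complex.Re (f t)) +i*
   (\int[lebesgue_measure]_t complex.Im (f t))).
Proof.
move=> x0 v0 f fr fi.
have ix0 : iota x != 0 by rewrite fmorph_eq0.
have isx0 : iota (sigma x) != 0 by rewrite !fmorph_eq0.
rewrite (@integral_orbit_complex R (character_at iota sigma l0 m0 x) eta v (iota x) (iota (sigma x)) f)//.
rewrite /Theta_term /character_at rmorphM -/(character_at iota sigma l0 m0 x).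
by rewrite -mulrA [LHS]mulrC.
Qed.

Lemma Theta_term0 : Theta_term iota sigma eta l0 m0 v 0 = 0.
Proof. by rewrite /Theta_term !rmorph0 sgr0 !mulr0 addr0 !mul0r. Qed.

Section Units.
Variables (L : set K) (U : set K) (eps : K).
Hypotheses (hUunit : forall u, U u -> field_unit u)
    (hUpos : forall u, U u -> totally_positive iota sigma u)
    (hUa : preserves_coset U L l0)
    (hUb : preserves_character sigma U L l0 m0)
    (heps : generator_of U eps) (heps1 : 1 < iota eps).

Lemma cexp_period (n : int) : cexp (- (2 * pi%:C * 'i%C * (n%:~R : R)%:C)) = 1.
Proof.
have two : (2 : R)%:C = 2 by rewrite (rmorph_nat (real_complex R)).
set c : R[i] := 2 * pi%:C * 'i%C.
have cE : c = (pi *+ 2)*i.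
  by rewrite /c -two; apply: complex_eq; rewrite !(Re_mul, Im_mul)/= ?mulr2n; ring.
have c1 : cexp c = 1.
  by rewrite cE cexpE /= expR0 cos2pi sin2pi mulr1 mulr0.
have cN1 : cexp (- c) = 1 by rewrite -[LHS]mulr1 -[in LHS]c1 -cexpD addNr cexp0.
elim/int_rect: n => [|n IH|n IH]; first by rewrite mulr0 oppr0 cexp0.
  rewrite intS rmorphD (rmorphD (real_complex R))/= mulrDr mulr1 opprD cexpD cN1 mul1r.
  exact: IH.
rewrite intS opprD rmorphD (rmorphD (real_complex R))/= mulrDr opprD cexpD IH mulr1.
by rewrite mulrN1z (rmorphN1 (real_complex R))/= mulrN1 opprK.
Qed.

Lemma cexp_periodD (y : R) (n : int) :
  cexp (- (2 * pi%:C * 'i%C * (y + n%:~R)%:C)) = cexp (- (2 * pi%:C * 'i%C * y%:C)).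
Proof.
have := cexp_period n; move: (2 * pi%:C * 'i%C) => c cn.
by rewrite (rmorphD (real_complex R))/= mulrDr opprD cexpD cn mulr1.
Qed.

Lemma character_unit u x : U u -> translate l0 L x ->
  character_at iota sigma l0 m0 (u * x) = character_at iota sigma l0 m0 x.
Proof.
move=> Uu [l Ll <-]; rewrite /character_at; congr (_ * _).
have [[k1 e1] [k2 e2]] := hUb Ll Uu.
(* The increment is the trace for ul - l plus the trace for u l0 - l0; each of the two congruences
   supplies one. *)
have -> : trQ (sigma (u * (l0 + l) - l0) * m0) = trQ (sigma (l0 + l - l0) * m0) + (k1 + k2 *+ 2)%:~R.
  have tD (y z : K) : trQ (y + z) = trQ y + trQ z.
    by rewrite !(trQE hK hsigma hsigma1) rmorphD/=; ring.
  have tN (y : K) : trQ (- y) = - trQ y.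
    by rewrite !(trQE hK hsigma hsigma1) rmorphN/=; ring.
  rewrite [l0 + l]addrC addrK mulrDr !rmorphB !rmorphD/= !mulrBl !mulrDl !tD tN.
  by rewrite -mulr2n -e2 -[k1%:~R]mulr1n -e1; ring.
by rewrite (rmorphD iota) (rmorph_int iota) cexp_periodD.
Qed.

Let A := ln (iota eps).

Lemma ln_unit_gt0 : 0 < A. Proof. by rewrite ln_gt0. Qed.

Let Ueps k : U (eps ^ k). Proof. by rewrite heps; exists k. Qed.

Lemma iota_expz k : iota (eps ^ k) = expR (A * k%:~R).
Proof.
have e : expR A = iota eps by rewrite lnK// posrE (lt_trans ltr01).
case: k => n; first by rewrite -exprnP rmorphXn/= -e expRM_natr.
by rewrite NegzE -exprnN fmorphV rmorphXn/= mulrNz mulrN expRN expRM_natr e.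
Qed.

Lemma sigma_iota_expz k : iota (sigma (eps ^ k)) = expR (- (A * k%:~R)).
Proof.
have := norm_unit_eq1 hK hsigma hsigma1 (hUunit (Ueps k)) (hUpos (Ueps k)).
move/(congr1 iota); rewrite rmorphM rmorph1 iota_expz expRN => h.
by apply: (mulfI (lt0r_neq0 (expR_gt0 (A * k%:~R)))); rewrite h divff// gt_eqF ?expR_gt0.
Qed.

(** As eps^k has norm 1, it scales the two coordinates by e^(Ak) and e^(-Ak). The exponents carry
    t/2, whence the shift by 2Ak. *)
Lemma orbit_fun_translation s k t : translate l0 L s ->
  orbit_fun iota sigma l0 m0 eta v (eps ^ k * s) t =
  orbit_fun iota sigma l0 m0 eta v s (t + 2 * A * k%:~R).
Proof.
move=> Xs; rewrite /orbit_fun character_unit//.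
have -> // : cplx_point iota sigma t (eps ^ k * s) = cplx_point iota sigma (t + 2 * A * k%:~R) s.
rewrite /cplx_point !rmorphM/= iota_expz sigma_iota_expz.
congr (_ +i* _); rewrite mulrAC -expRD mulrC; congr (_ * expR _); by field.
Qed.

(* The units fix 0, so 0 has to be left out; its terms vanish on both sides. *)
Lemma orbit_bij (S : set K) : orbit_representatives U (translate l0 L) S ->
  set_bij ((S `&` ~` [set 0]) `*` [set: int]) (translate l0 L `&` ~` [set 0])
    (fun p => eps ^ p.2 * p.1).
Proof.
move=> [SX hS].
have eps0 k : eps ^ k != 0 by have [] := hUunit (Ueps k).
split.
- move=> [s k] [[/= Ss s0] _]; split.
    by rewrite -(hUa (Ueps k)); exists s => //; exact: SX.
  by move=> /= /eqP; rewrite mulf_eq0 (negbTE (eps0 k)) => /eqP.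
- move=> [s k] [s' k'] /set_mem[[/= Ss s0] _] /set_mem[[/= Ss' s'0] _] e.
  (* Both represent the orbit of [eps ^ k * s]. Once they agree, the nonzero [s] cancels, and log
     eps > 0 separates the powers. *)
  have ss : s = s'.
    have [|w [_ wu]] := hS (eps ^ k * s).
      by rewrite -(hUa (Ueps k)); exists s => //; exact: SX.
    rewrite -(wu s); last by split=> //; exists (eps ^ k).
    by apply: wu; split=> //; exists (eps ^ k').
  move: e; rewrite -ss => /(mulIf (introN eqP s0)) /(congr1 iota).
  rewrite !iota_expz => /expR_inj /(mulfI (lt0r_neq0 ln_unit_gt0)) /eqP.
  by rewrite eqr_int => /eqP ->.
- move=> x [Xx x0]; have [s [[Ss [u Uu xu]] _]] := hS x Xx.
  move: Uu xu; rewrite heps => -[k _ <-] xE.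
  exists (s, k) => //=; split=> //; split=> // /= s0; apply: x0.
  by rewrite /= xE s0 mulr0.
Qed.
End Units.
End Arithmetic.

Section MainSums.
Variables (R : realType) (K : splittingFieldType rat).
Hypothesis hK : \dim {:K} = 2%N.
Variables (iota : {rmorphism K -> R}) (sigma : gal_of {:K}).
Hypotheses (hsigma : sigma \in 'Gal({:K} / 1)%g) (hsigma1 : sigma != 1%g).
Variables (L : set K) (hL : free_rank2 L) (l0 m0 : K) (eta v : R[i]).
Hypothesis hv : 0 < complex.Im v.
Local Notation normc := (@ComplexField.Normc.normc R).
Local Notation Y := (translate l0 L).
Local Notation F := (orbit_fun iota sigma l0 m0 eta v).

(** The right-hand side of [orbit_fun_le], which is free of t. *)
Definition orbit_bound (A : R) (x : K) : R :=
  (`|complex.Re eta| + `|complex.Im eta|) * expR (A / 2) *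
  ((`|iota x| + `|iota (sigma x)|) *
   expR (- (pi * complex.Im v * expR (- A)) * (iota x ^+ 2 + iota (sigma x) ^+ 2))).

Lemma coset_bij : exists a b : K,
  (forall m n : int, a *~ m + b *~ n = 0 -> m = 0 /\ n = 0) /\
  set_bij [set: int * int] Y (fun z => l0 + (a *~ z.1 + b *~ z.2)).
Proof.
have [a [b [free LE]]] := hL; exists a, b; split=> //; split.
- by move=> z _; exists (a *~ z.1 + b *~ z.2) => //; rewrite LE; exists z.1, z.2.
- move=> [m n] [m' n'] _ _ /= /addrI/eqP.
  rewrite -subr_eq0 opprD addrACA -!mulrzBr => /eqP /free[/eqP + /eqP].
  by rewrite !subr_eq0 => /eqP -> /eqP ->.
- by move=> _ [l + <-]; rewrite LE => -[m [n ->]]; exists (m, n).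
Qed.

Lemma countable_coset : countable Y.
Proof.
have [a [b [_ [_ _ eY]]]] := coset_bij.
exact: card_le_trans (surj_card_ge eY) (countableP _).
Qed.

Lemma orbit_bound_lty A : (\esum_(x in Y) (orbit_bound A x)%:E < +oo)%E.
Proof.
have [a [b [free eY]]] := coset_bij; rewrite (reindex_esum _ _ _ _ eY).
set e := (fun z : int * int => _) in eY *; rewrite esumZl; last 2 first.
- by rewrite mulr_ge0 ?addr_ge0 ?expR_ge0.
- by move=> z; rewrite mulr_ge0 ?addr_ge0 ?expR_ge0.
have c0 : 0 < pi * complex.Im v * expR (- A) by rewrite !mulr_gt0 ?pi_gt0 ?expR_gt0.
have fin := @gauss_lattice_lty R (iota a) (iota b) (iota (sigma a)) (iota (sigma b))
  (iota l0) (iota (sigma l0)) _ (fun z => iota (e z)) (fun z => iota (sigma (e z))) _ _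
  (det_conj_neq0 hK iota hsigma hsigma1 free) c0.
rewrite lte_mul_pinfty ?lee_fin ?mulr_ge0 ?addr_ge0 ?expR_ge0//.
apply: fin => z; rewrite /e !rmorphD/= -[a *~ _]mulrzr -[b *~ _]mulrzr !rmorphM/= !rmorph_int.
  by rewrite [iota a * _]mulrC [iota b * _]mulrC.
by rewrite [iota (sigma a) * _]mulrC [iota (sigma b) * _]mulrC.
Qed.

Lemma lattice_bij t : set_bij Y (cplx_lattice iota sigma t L)
  (fun x => cplx_point iota sigma t (x - l0)).
Proof.
split.
- by move=> _ [l Ll <-]; exists l => //; rewrite [l0 + l]addrC addrK.
- by move=> x y _ _ /cplx_point_inj/addIr.
- by move=> _ [l Ll <-]; exists (l0 + l); [exists l|rewrite [l0 + l]addrC addrK].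
Qed.

Local Notation term t := (theta_term eta (cplx_point iota sigma t l0)
  (cplx_point iota sigma t m0) v).

Lemma theta_term_orbit t x : term t (cplx_point iota sigma t (x - l0)) = F x t.
Proof. by rewrite (theta_termE hK iota hsigma hsigma1) addrC subrK. Qed.

Lemma theta_summable t : abs_summable (cplx_lattice iota sigma t L) (term t).
Proof.
rewrite /abs_summable /summable (reindex_esum _ _ _ _ (lattice_bij t)).
(* For a single t the interval [-|t|, |t|] serves. *)
apply: le_lt_trans (orbit_bound_lty `|t|); apply: le_esum => x _.
rewrite theta_term_orbit gee0_abs ?lee_fin; first exact: orbit_fun_le.
exact: normc_ge0.
Qed.

Lemma orbit_fun0 t : F 0 t = 0.
Proof.
by rewrite /orbit_fun sprod_cplx_point !rmorph0 !mul0r addr0 mul0r mulr0.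
Qed.

Lemma theta_csum t : csum (cplx_lattice iota sigma t L) (term t) =
  csum (Y `&` ~` [set 0]) (F^~ t).
Proof.
rewrite /csum; congr (_ +i* _); rewrite (rsum_reindex _ (lattice_bij t)).
  rewrite -[RHS]rsum_support; last first.
    by move=> x _ /contrapT ->; rewrite orbit_fun0.
  by apply: eq_rsum => x _; rewrite -theta_term_orbit.
rewrite -[RHS]rsum_support; last first.
  by move=> x _ /contrapT ->; rewrite orbit_fun0.
by apply: eq_rsum => x _; rewrite -theta_term_orbit.
Qed.

End MainSums.

(* sqrtc is the principal branch, which has positive real part at -iv
   for v in the upper half plane and is positive for v on the positive imaginary axis.
   The equation is accompanied by the convergence of its two sides. *)
Theorem proposition2p6 (R : realType) (K : splittingFieldType rat)
    (hK : \dim {:K} = 2%N) (iota : {rmorphism K -> R})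
    (sigma : gal_of {:K}) (hsigma : sigma \in 'Gal({:K} / 1)%g)
    (hsigma1 : sigma != 1%g)
    (L : set K) (hL : free_rank2 L) (l0 m0 : K) (eta : R[i])
    (U : set K) (hUinf : infinite_set U)
    (hUunit : forall u, U u -> field_unit u)
    (hUpos : forall u, U u -> totally_positive iota sigma u)
    (hUa : preserves_coset U L l0)
    (hUb : preserves_character sigma U L l0 m0)
    (eps : K) (heps : generator_of U eps) (heps1 : 1 < iota eps)
    (S : set K) (hS : orbit_representatives U (translate l0 L) S)
    (v : R[i]) (hv : 0 < complex.Im v) :
  let theta_t t := theta (cplx_lattice iota sigma t L) eta
                     (cplx_point iota sigma t l0) (cplx_point iota sigma t m0) v
  in
  [/\ abs_summable S (Theta_term iota sigma eta l0 m0 v),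
      forall t, abs_summable (cplx_lattice iota sigma t L)
        (theta_term eta (cplx_point iota sigma t l0)
           (cplx_point iota sigma t m0) v),
      cintegrable (- ln (iota eps)) (ln (iota eps)) theta_t
    & Theta iota sigma S eta l0 m0 v =
      sqrtc (- 'i%C * v) * cintegral (- ln (iota eps)) (ln (iota eps)) theta_t].

Proof.
move=> theta_t; set A := ln (iota eps).
have A0 : 0 < A by exact: ln_unit_gt0 heps1.
pose F := orbit_fun iota sigma l0 m0 eta v.
pose X := translate l0 L `&` ~` [set 0]; pose S' := S `&` ~` [set 0].
pose M := orbit_bound iota sigma eta v A.
have cX : countable X.
  have XY : X `<=` translate l0 L by move=> x [].
  have cY : countable (translate l0 L) := countable_coset hL l0.
  exact: card_le_trans (subset_card_le XY) cY.
have eX := orbit_bij hUunit hUa heps heps1 hS.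
have Fe s k t : S' s -> F (eps ^ k * s) t = F s (t + 2 * A * k%:~R).
  move=> [Ss _]; apply: (orbit_fun_translation hK hsigma hsigma1 eta v hUunit hUpos hUb heps heps1).
  by case: hS => + _; apply.
have FM x t : X x -> t \in `[- A, A] -> ComplexField.Normc.normc (F x t) <= M x.
  by move=> _; rewrite in_itv/= -ler_norml => tA; exact: orbit_fun_le.
have Mfin : (\esum_(x in X) (M x)%:E < +oo)%E.
  apply: le_lt_trans (orbit_bound_lty hK iota hsigma hsigma1 hL l0 eta hv A).
  have M0 x : (0 <= (M x)%:E)%E by rewrite lee_fin !mulr_ge0 ?addr_ge0 ?expR_ge0.
  by rewrite [leRHS](esumID (~` [set 0]))// leeDl// esum_ge0.
have cr x : continuous (fun t => complex.Re (F x t)).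
  exact: (continuous_orbit_fun iota sigma l0 m0 eta v x).1.
have ci x : continuous (fun t => complex.Im (F x t)).
  exact: (continuous_orbit_fun iota sigma l0 m0 eta v x).2.
have re s k t : S' s -> complex.Re (F (eps ^ k * s) t) = complex.Re (F s (t + 2 * A * k%:~R)).
  by move=> Ss; rewrite Fe.
have ie s k t : S' s -> complex.Im (F (eps ^ k * s) t) = complex.Im (F s (t + 2 * A * k%:~R)).
  by move=> Ss; rewrite Fe.
have rM x t : X x -> t \in `[- A, A] -> `|complex.Re (F x t)| <= M x.
  by move=> Xx tA; exact: le_trans (normc_ge_absRe _) (FM x t Xx tA).
have iM x t : X x -> t \in `[- A, A] -> `|complex.Im (F x t)| <= M x.
  by move=> Xx tA; exact: le_trans (normc_ge_absIm _) (FM x t Xx tA).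
have [rint rE] := integral_rsum_unfold cX A0 eX cr re rM Mfin.
have [iint iE] := integral_rsum_unfold cX A0 eX ci ie iM Mfin.
have rS := summable_unfold cX A0 eX cr re rM Mfin.
have iS := summable_unfold cX A0 eX ci ie iM Mfin.
have rI s : S' s -> _ := integrable_orbit cX A0 eX cr re rM Mfin (s := s).
have iI s : S' s -> _ := integrable_orbit cX A0 eX ci ie iM Mfin (s := s).
(* The integral over the whole line attached to one orbit; by [Theta_termE] it gives the term of the
   pseudolattice series up to the square root. *)
pose h s : R[i] := (\int[lebesgue_measure]_t complex.Re (F s t)) +i*
  (\int[lebesgue_measure]_t complex.Im (F s t)).
have ThetaE s : S' s -> Theta_term iota sigma eta l0 m0 v s = sqrtc (- 'i%C * v) * h s.
  move=> S's; have /eqP s0 : s <> 0 by case: S's.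
  exact: (Theta_termE s0 hv (rI s S's) (iI s S's)).
have sr : rsummable S' (fun s => complex.Re (h s)).
  apply: le_lt_trans rS; apply: le_esum => s Ss.
  have := rI s Ss => I; rewrite EFin_normr_Rintegral//.
  by apply: le_abse_integral => //; exact: measurable_int I.
have si : rsummable S' (fun s => complex.Im (h s)).
  apply: le_lt_trans iS; apply: le_esum => s Ss.
  have := iI s Ss => I; rewrite EFin_normr_Rintegral//.
  by apply: le_abse_integral => //; exact: measurable_int I.
have thetaE t : theta_t t = csum X (F ^~ t).
  exact: (theta_csum hK iota hsigma hsigma1).
have T0 s : ~ (~` [set 0]) s -> Theta_term iota sigma eta l0 m0 v s = 0.
  by move=> /contrapT ->; exact: Theta_term0.
split.
(* Absolute convergence of the pseudolattice series also comes from the unfolding: the norms of the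
   f_s, summable over the orbits, bound both components of [h s]. *)
- rewrite /abs_summable /summable (@esum_support _ _ S (~` [set 0]))//; last first.
    by move=> s _ /T0 ->; rewrite ComplexField.Normc.normc0 abse0.
  set c := sqrtc (- 'i%C * v).
  have fin : (\esum_(s in S') (ComplexField.Normc.normc c *
      (`|complex.Re (h s)| + `|complex.Im (h s)|))%:E < +oo)%E.
    rewrite esumZl ?normc_ge0//.
    apply: lte_mul_pinfty; rewrite ?lee_fin ?normc_ge0//.
    under eq_esum do rewrite EFinD.
    by rewrite esumD//; exact: lte_add_pinfty sr si.
  apply: le_lt_trans fin; apply: le_esum => s Ss.
  rewrite ThetaE// ComplexField.Normc.normcM gee0_abs ?lee_fin; last by rewrite mulr_ge0// normc_ge0.
  by rewrite ler_wpM2l ?normc_ge0 ?normc_le_abs.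
- by move=> t; exact: (theta_summable hK iota hsigma hsigma1).
- rewrite /cintegrable; split.
    rewrite (_ : (fun t => _) = EFin \o (fun t => rsum X (fun x => complex.Re (F x t))))//.
    by apply/funext => t; rewrite thetaE.
  rewrite (_ : (fun t => _) = EFin \o (fun t => rsum X (fun x => complex.Im (F x t))))//.
  by apply/funext => t; rewrite thetaE.
(* The unfolding is applied to each component; the complex factor mixes the components and is
   therefore taken out of the sum by [csumZ]. *)
- have -> : cintegral (- A) A theta_t = csum S' h.
    rewrite /cintegral /csum -rE -iE; congr (_ +i* _); apply: eq_Rintegral => t _.
      by rewrite thetaE.
    by rewrite thetaE.
  rewrite -csumZ// /Theta /csum; congr (_ +i* _).
    rewrite (@rsum_support _ _ S (~` [set 0])).
      by apply: eq_rsum => s Ss; rewrite ThetaE.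
    by move=> s _ /T0 ->.
  rewrite (@rsum_support _ _ S (~` [set 0])).
    by apply: eq_rsum => s Ss; rewrite ThetaE.
  by move=> s _ /T0 ->.
Qed.
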